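(* Let $n\ge 2$ be an integer, $0<b<1$ and $\theta\in[0,1)$. Consider the all-pay auction with $n$ bidders in which each bidder is independently a low type (budget $b$) with probability $\theta$ and a high type (budget $1$) with probability $1-\theta$, types being private information. For a type that is present with probability zero, the formula for its strategy is to be disregarded. (I) If $b<\theta^{n-1}$, then there exists a unique symmetric equilibrium. In it: (a) High types randomize in the interval $[b,\,1-\theta^{n-1}+b]$ according to the cdf $$G_h(p)=\frac{(p+\theta^{n-1}-b)^{\frac1{n-1}}-\theta}{1-\theta}.$$ (b) If $b<\frac{\theta^{n-1}}{n}$, all low types bid $b$. If $\frac{\theta^{n-1}}{n}\le b<\theta^{n-1}$, low types use a mixed strategy $G_l$ on $[0,b]$ that has an atom of some size $\mu$ at $b$, where $$G_l(p)=\begin{cases}\dfrac{p^{\frac1{n-1}}}{\theta} & \text{if } 0\le p<(1-\mu)^{n-1}\theta^{n-1},\\[2mm] 1-\mu & \text{if } (1-\mu)^{n-1}\theta^{n-1}\le p<b,\\[1mm] 1 & \text{if } p=b,\end{cases}$$ and (for fixed $n,\theta$) the size $\mu$ of the atom falls as $b$ rises. (c) The equilibrium payoffs are $u_h(n)=\theta^{n-1}-b$, while $u_l(n)=0$ if $b\ge \frac{\theta^{n-1}}{n}$ and $u_l(n)=\frac{\theta^{n-1}}{n}-b$ otherwise. (II) If $\theta^{n-1}\le b$, then in any symmetric equilibrium the seller extracts the entire surplus while all bidders earn zero, i.e. $\pi(n)=1$ and $u_h(n)=u_l(n)=0$. The following strategies constitute such an equilibrium: low types continuously randomize in $[0,\theta^{n-1}]$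 and high types continuously randomize in $[\theta^{n-1},1]$ according to the cdfs $$G_l(p)=\frac{p^{\frac1{n-1}}}{\theta}\qquad\text{and}\qquad G_h(p)=\frac{p^{\frac1{n-1}}-\theta}{1-\theta}.$$
   Context: All-pay auction: one indivisible good is sold by a seller whose reservation value is $0$. There are $n\ge2$ risk-neutral bidders, each of whom values the good at $1$. Each bidder is, independently of the others, a low type with probability $\theta$ and a high type with probability $1-\theta$; a bidder knows only his own type, and $n,\theta,b$ are common knowledge. Bidders simultaneously submit nonnegative bids; a low type can bid at most $b$ and a high type at most $1$. The highest bidder obtains the good, ties being broken uniformly at random among the tied highest bidders, and every bidder pays his own bid whether or not he wins. So a bidder who bids $p$ has expected payoff (probability of winning) $-\,p$. (Reserve prices play no role in the bidding stage with $n\ge2$ bidders.) A symmetric equilibrium is a pair of (possibly mixed) bidding strategies, one for low types with cdf $G_l$ and one for high types with cdf $G_h$, such that when all bidders of each type use the strategy of that type, no bidder of either type can increase his expected payoff by changing his feasible bid. $u_h(n)$ and $u_l(n)$ denote the expected equilibrium payoffs of a high type and a low type bidder, and $\pi(n)$ denotes the seller's expected revenue (the expected sum of all $n$ bids). *)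

(* Defs.v *)
From HB Require Import structures.
From mathcomp Require Import all_boot all_order all_algebra.
From mathcomp Require Import all_classical all_reals all_analysis.

Set Implicit Arguments.
Unset Strict Implicit.
Unset Printing Implicit Defensive.
Import Order.TTheory GRing.Theory Num.Theory.
Import numFieldNormedType.Exports.
Local Open Scope classical_set_scope.
Local Open Scope ring_scope.

Definition strategy (R : realType) := probability (measurableTypeR R) R.

Section AllPayAuction.
Context {R : realType}.
Implicit Types (n : nat) (theta b p : R) (L H : strategy R) (s : seq R).

(* Only the values on measurable sets are meaningful, hence not [L = L']. *)
Definition same_strategy L L' : Prop :=
  forall A : set (measurableTypeR R), measurable A -> L A = L' A.

(* The cdf is prescribed on [a, c] only: [L `[a, c] = 1] determines it
   elsewhere. *)
Definition randomizes_in L (a c : R) (G : R -> R) : Prop :=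
  L `[a, c]%classic = 1%E /\
  (forall p, a <= p <= c -> L `]-oo, p]%classic = (G p)%:E).

(* A type is drawn first, then a bid from the strategy of that type. *)
Definition expect_bid theta L H (f : R -> \bar R) : \bar R :=
  (theta%:E * (\int[L]_x f x) + (1 - theta)%:E * (\int[H]_x f x))%E.

(* Iterated integration, i.e. [k] independent draws of a type and a bid. *)
Fixpoint expect_bids theta L H (k : nat) (f : seq R -> \bar R) : \bar R :=
  if k is k'.+1 then
    expect_bid theta L H
      (fun x => expect_bids theta L H k' (fun s => f (x :: s)))
  else f [::].

(* Probability that the tie-breaking rule awards the good to a bid [p] against
   the bids [s] of the others. *)
Definition share p s : R :=
  if all (fun q => q <= p) s then ((count_mem p s).+1%:R)^-1 else 0.

Definition win_prob n theta L H p : \bar R :=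
  expect_bids theta L H n.-1 (fun s => (share p s)%:E).

Definition bid_payoff n theta L H p : \bar R :=
  (win_prob n theta L H p - p%:E)%E.

Definition u_low n theta L H : \bar R :=
  (\int[L]_p bid_payoff n theta L H p)%E.

Definition u_high n theta L H : \bar R :=
  (\int[H]_p bid_payoff n theta L H p)%E.

Definition revenue n theta L H : \bar R :=
  expect_bids theta L H n (fun s => (\sum_(x <- s) x)%:E).

(* Optimality is required of the strategy's expected payoff, not of every point
   of its support. It is also required of a type of probability 0. *)
Definition symmetric_equilibrium n theta b L H : Prop :=
  [/\ L `[0, b]%classic = 1%E,
      H `[0, 1]%classic = 1%E,
      forall p, 0 <= p <= b -> (bid_payoff n theta L H p <= u_low n theta L H)%E
    & forall p, 0 <= p <= 1 -> (bid_payoff n theta L H p <= u_high n theta L H)%E].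

Definition Gh_small n theta b p : R :=
  ((p + theta ^+ n.-1 - b) `^ (n.-1%:R^-1) - theta) / (1 - theta).

Definition Gl_atom n theta b (mu : R) p : R :=
  if p < (1 - mu) ^+ n.-1 * theta ^+ n.-1 then p `^ (n.-1%:R^-1) / theta
  else if p < b then 1 - mu
  else 1.

Definition Gl_large n theta p : R := p `^ (n.-1%:R^-1) / theta.

Definition Gh_large n theta p : R :=
  (p `^ (n.-1%:R^-1) - theta) / (1 - theta).

(* If [theta = 0] there are no low types and [L] is left unconstrained. *)
Definition large_budget_profile n theta L H : Prop :=
  (0 < theta -> randomizes_in L 0 (theta ^+ n.-1) (Gl_large n theta)) /\
  randomizes_in H (theta ^+ n.-1) 1 (Gh_large n theta).

End AllPayAuction.

(* Main.v *)
Require Import Defs.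
From HB Require Import structures.
From mathcomp Require Import all_boot all_order all_algebra.
From mathcomp Require Import all_classical all_reals all_analysis.
From mathcomp Require Import measurable_realfun.
From mathcomp Require Import ring lra.

Set Implicit Arguments.
Unset Strict Implicit.
Unset Printing Implicit Defensive.
Import Order.TTheory GRing.Theory Num.Theory.
Import numFieldNormedType.Exports.
Local Open Scope classical_set_scope.
Local Open Scope ring_scope.

(* Let [F] be the cdf of the bid of a random opponent. A bid just above [p] wins
   with probability at least [F p ^ (n - 1)], so [F p ^ (n - 1) <= u + p] for every
   [p] below the largest feasible bid of a type with payoff [u]. Almost every bid
   drawn by the type attains [u]; at such a [p] equality holds and [F] does not
   jump. Passing to the infimum of the optimal bids above [p] gives equality at
   every [p] that is not followed by a gap, which determines the cdfs of both
   types. Only low types can have an atom, and only at [b]; unless all of them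
   bid [b], its size is fixed by indifference between bidding [b] and earning [0].
   If [theta ^ (n - 1) <= b], comparing the lowest bids of the two types forces
   both payoffs to vanish; as the winning probabilities of the [n] bidders add up
   to one, the revenue is then one. *)

(** * Distribution functions of strategies *)

(** Tie-breaking enters only through [tie_win N x y], the chance of winning when each of [N]
    opponents bids below [p] with probability [x] and at most [p] with probability [y]. It is the
    mean of [s^N] over [[x, y]], so for [N > 0] it stays strictly below [y^N] unless [x = y]: a tie
    is worse than bidding slightly more. A low type cannot bid more at [b], so an atom may survive
    there. A high type cannot at [1] either, but at that price even a certain win leaves nothing,
    which again rules out a tie. The thresholds for [b] are values of the same function.
    Indifference of low types reads [tie_win N (theta * (1 - mu)) theta = b]; for [theta > 0] its
    left side decreases strictly from [theta^N] at [mu = 0] to [theta^N / N.+1] at [mu = 1].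
    Existence, uniqueness and monotonicity of the atom all come from this equation. Equilibrium
    constrains expected payoffs only, and nothing is known in advance about supports or continuity.
    Hence the arguments run on the measurable set of optimal bids, which has full probability but
    need not be closed, and on one-sided limits of cdfs. *)

Section StrategyCdf.
Context {R : realType}.
Implicit Types (P : strategy R) (p q : R) (A B : set (measurableTypeR R)).

Definition prob P A : R := fine (P A).
Definition cdf_le P p : R := prob P `]-oo, p]%classic.
Definition cdf_lt P p : R := prob P `]-oo, p[%classic.

Lemma probE P A : measurable A -> P A = (prob P A)%:E.
Proof. by move=> mA; rewrite /prob fineK// fin_num_measure. Qed.

Lemma prob_ge0 P A : 0 <= prob P A.
Proof. by rewrite /prob fine_ge0. Qed.

Lemma prob_le1 P A : measurable A -> prob P A <= 1.
Proof. by move=> mA; rewrite -lee_fin -probE// probability_le1. Qed.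

Lemma prob_mono P A B : measurable A -> measurable B -> A `<=` B ->
  prob P A <= prob P B.
Proof.
by move=> mA mB AB; rewrite -lee_fin -!probE// le_measure ?inE.
Qed.

Lemma probU P A B : measurable A -> measurable B -> A `&` B = set0 ->
  prob P (A `|` B) = prob P A + prob P B.
Proof.
move=> mA mB AB; apply: EFin_inj.
by rewrite EFinD -!probE ?measureU//; exact: measurableU.
Qed.

Lemma probD P A B : measurable A -> measurable B -> A `<=` B ->
  prob P (B `\` A) = prob P B - prob P A.
Proof.
move=> mA mB AB.
rewrite -[in RHS](setDUK AB) probU ?setDIK//; last exact: measurableD.
by rewrite addrAC subrr add0r.
Qed.

Lemma prob_full_setI P A B : measurable A -> measurable B -> prob P A = 1 ->
  prob P (A `&` B) = prob P B.
Proof.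
move=> mA mB A1; apply: EFin_inj.
rewrite -[B in RHS](setIT B) -(setUv A) setIUr probU; last 3 first.
- exact: measurableI.
- by apply: measurableI => //; exact: measurableC.
- by rewrite setIACA setICr setI0.
rewrite setIC (_ : prob P (B `&` ~` A) = 0) ?addr0//.
apply/eqP; rewrite eq_le prob_ge0 andbT.
have -> : 0 = prob P (~` A).
  rewrite -setTD probD// A1.
  by rewrite /prob (@probability_setT _ _ _ P)/= subrr.
by apply: prob_mono => //; [apply: measurableI => //|]; exact: measurableC.
Qed.

Lemma cdf_le_nd P p q : p <= q -> cdf_le P p <= cdf_le P q.
Proof. by move=> pq; apply: prob_mono => //; apply: subset_itvl; rewrite bnd_simp. Qed.

Lemma cdf_lt_nd P p q : p <= q -> cdf_lt P p <= cdf_lt P q.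
Proof. by move=> pq; apply: prob_mono => //; apply: subset_itvl; rewrite bnd_simp. Qed.

Lemma cdf_lt_le P p : cdf_lt P p <= cdf_le P p.
Proof. by apply: prob_mono => //; apply: subset_itvl; rewrite bnd_simp. Qed.

Lemma cdf_le_lt P p q : p < q -> cdf_le P p <= cdf_lt P q.
Proof. by move=> pq; apply: prob_mono => //; apply: subset_itvl; rewrite bnd_simp. Qed.

Lemma cdf_le_ge0 P p : 0 <= cdf_le P p. Proof. exact: prob_ge0. Qed.
Lemma cdf_lt_ge0 P p : 0 <= cdf_lt P p. Proof. exact: prob_ge0. Qed.
Lemma cdf_le_le1 P p : cdf_le P p <= 1. Proof. exact: prob_le1. Qed.

Lemma prob_itvoo P p q : p < q -> prob P `]p, q[%classic = cdf_lt P q - cdf_le P p.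
Proof.
move=> pq; rewrite -probD//; last by apply: subset_itvl; rewrite bnd_simp.
congr prob; apply/seteqP; split=> x /=; rewrite !in_itv/=.
  by move=> /andP[px xq]; split => //; apply/negP; rewrite -ltNge.
by move=> [-> /negP]; rewrite -ltNge => ->.
Qed.

Lemma prob_itvcc P p q : p <= q -> prob P `[p, q]%classic = cdf_le P q - cdf_lt P p.
Proof.
move=> pq; rewrite -probD//; last by apply: subset_itvl; rewrite bnd_simp.
congr prob; apply/seteqP; split=> x /=; rewrite !in_itv/=.
  by move=> /andP[px xq]; split => //; apply/negP; rewrite -leNgt.
by move=> [-> /negP]; rewrite -leNgt => ->.
Qed.

Lemma prob_set1 P p : prob P [set p] = cdf_le P p - cdf_lt P p.
Proof. by rewrite -prob_itvcc// set_itv1. Qed.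

Lemma cdf_le_rc P q (N : nat) (c : R) :
  (forall t, q < t -> c <= cdf_le P t ^+ N) -> c <= cdf_le P q ^+ N.
Proof.
move=> h.
(* Right continuity is available for cdfs of random variables; the identity under [P] has law
   [P]. *)
pose idR : measurableTypeR R -> R := idfun.
have mid : measurable_fun setT idR by exact: measurable_id.
pose X : {RV P >-> R} := HB.pack_for {RV P >-> R} idR (@isMeasurableFun.Build _ _ _ _ idR mid).
have rc : cdf_le P t @[t --> q^'+] --> cdf_le P q.
  apply: fine_cvg; rewrite fineK ?fin_num_measure//.
  exact: (@cdf_right_continuous _ _ _ P X q).
have rcN : cdf_le P t ^+ N @[t --> q^'+] --> cdf_le P q ^+ N.
  by apply: (cvg_comp _ (fun x : R => x ^+ N) rc); exact: exprn_continuous.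
rewrite -(cvg_lim _ rcN)//; apply: limr_ge.
  by apply/cvg_ex; exists (cdf_le P q ^+ N).
near=> t; apply: h; near: t; exact: nbhs_right_gt.
Unshelve. all: by end_near. Qed.

Lemma cdf_lt_lc P q (c : R) : (forall t, t < q -> cdf_le P t <= c) -> cdf_lt P q <= c.
Proof.
move=> h.
pose F n := `]-oo, (q - n.+1%:R^-1)]%classic : set (measurableTypeR R).
have UF : \bigcup_n F n = `]-oo, q[%classic.
  apply/seteqP; split=> [x [n _]|x]; rewrite /F /= !in_itv/=.
    by move=> /le_lt_trans; apply; rewrite ltrBlDr ltrDl.
  move=> xq; exists (Num.truncn (q - x)^-1) => //=; rewrite in_itv/=.
  rewrite lerBrDr -lerBrDl -[leRHS]invrK lef_pV2 ?posrE ?invr_gt0 ?subr_gt0//.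
  by rewrite ltW// truncnS_gt.
have : P (F n) @[n --> \oo] --> P (\bigcup_n F n).
  apply: nondecreasing_cvg_mu; [|by rewrite UF|].
    by move=> n; exact: measurable_itv.
  move=> n m nm; apply/subsetPset; apply: subset_itvl; rewrite bnd_simp.
  by rewrite lerD2l lerN2 lef_pV2 ?posrE// ler_nat.
rewrite UF => cv; rewrite -lee_fin -probE//.
rewrite -(cvg_lim _ cv)//; apply: lime_le; first by apply/cvg_ex; eexists; exact: cv.
near=> n; rewrite /= probE /F ?lee_fin//; apply: h.
by rewrite ltrBlDr ltrDl.
Unshelve. all: by end_near. Qed.

(** The rays []p, +oo[] generate the Borel sets, are stable under intersection and exhaust the line,
    so they determine a finite measure. *)
Lemma cdf_le_unique P Q : (forall p, cdf_le P p = cdf_le Q p) -> same_strategy P Q.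
Proof.
move=> PQ A mA.
have PQC p : P `]p, +oo[%classic = Q `]p, +oo[%classic.
  rewrite -(setCitvl (BRight p)) !probability_setC// !probE//.
  by congr (_ - _%:E)%E; exact: PQ.
have mG : @measurable _ (measurableTypeR R) = <<s @RGenOInfty.G R >>.
  exact: RGenOInfty.measurableE.
apply: (@measure_unique _ R (measurableTypeR R) _
  (fun k => `](- (k%:R : R)), +oo[%classic) mG) => //.
- move=> _ _ [p ->] [q ->]; exists (Num.max p q).
  by apply/seteqP; split => x /=; rewrite !in_itv/= !andbT gt_max; [move=> [-> ->]|move=> /andP].
- by move=> k; exists (- k%:R).
- rewrite -subTset => t _/=.
  by exists (Num.bound t) => //=; rewrite in_itv/= andbT ltrNl unstable.ltrNbound.
- by move=> _ [p ->]; exact: PQC.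
- by move=> k; apply: le_lt_trans (probability_le1 _ _) (ltry 1).
Qed.

Lemma cdf_le_out P (a c p : R) : P `[a, c]%classic = 1%E ->
  (p < a -> cdf_le P p = 0) /\ (c <= p -> cdf_le P p = 1).
Proof.
move=> P1; have {}P1 : prob P `[a, c]%classic = 1 by rewrite /prob P1.
split=> [pa|cp].
  rewrite /cdf_le -(prob_full_setI _ _ P1)//.
  rewrite (_ : _ `&` _ = set0) /prob ?measure0//.
  apply/seteqP; split => x //=; rewrite !in_itv/= => -[/andP[ax _] xp].
  by move: (lt_le_trans pa (le_trans ax xp)); rewrite ltxx.
apply/eqP; rewrite eq_le cdf_le_le1/= -{1}P1; apply: prob_mono => //.
by move=> x /=; rewrite !in_itv/= => /andP[_ /le_trans]; apply.
Qed.

Lemma randomizes_unique P Q (a c : R) (G : R -> R) : randomizes_in P a c G ->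
  randomizes_in Q a c G -> same_strategy P Q.
Proof.
move=> [P1 PG] [Q1 QG]; apply: cdf_le_unique => p.
have [P0 P1'] := cdf_le_out p P1; have [Q0 Q1'] := cdf_le_out p Q1.
have [pa|ap] := ltP p a; first by rewrite P0 ?Q0.
have [cp|pc] := leP c p; first by rewrite P1' ?Q1'.
by rewrite /cdf_le /prob PG ?QG// ap ltW.
Qed.

End StrategyCdf.

(** * Winning probability *)

Section WinProbability.
Context {R : realType}.
Implicit Types (P L H M : strategy R) (p q x y m theta : R) (N k c : nat).

(** For [x <> y] this is the divided difference [(y^(N+1) - x^(N+1)) / ((N+1) (y - x))]. Written as
    a sum, it needs no separate case for a bid without ties. *)
Definition tie_win N x y : R :=
  (N.+1%:R)^-1 * \sum_(i < N.+1) y ^+ (N - i) * x ^+ i.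

Lemma tie_win_id N x : tie_win N x x = x ^+ N.
Proof.
rewrite /tie_win (eq_bigr (fun=> x ^+ N)); last first.
  by move=> i _; rewrite -exprD subnK// -ltnS.
by rewrite sumr_const card_ord -(mulr_natl (x ^+ N)) mulrA mulVf ?mul1r// pnatr_eq0.
Qed.

Lemma tie_win_le N x y x' y' : 0 <= x -> 0 <= y -> x <= x' -> y <= y' ->
  tie_win N x y <= tie_win N x' y'.
Proof.
move=> x0 y0 xx yy; apply: ler_wpM2l; first by rewrite invr_ge0.
apply: ler_sum => i _; apply: ler_pM; rewrite ?exprn_ge0//.
  by rewrite lerXn2r ?nnegrE// (le_trans y0).
by rewrite lerXn2r ?nnegrE// (le_trans x0).
Qed.

(** Strictness comes from the last summand [x ^+ N]; in [tie_win_ltr] it comes from the first,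
    [y ^+ N]. *)
Lemma tie_win_ltl N x x' y : (0 < N)%N -> 0 <= x -> 0 <= y -> x < x' ->
  tie_win N x y < tie_win N x' y.
Proof.
move=> N0 x0 y0 xx'; rewrite /tie_win ltr_pM2l ?invr_gt0 ?ltr0n//.
have x'0 : 0 <= x' by rewrite (le_trans x0)// ltW.
rewrite !big_ord_recr/= subnn !mul1r ler_ltD//; last first.
  by rewrite ltrXn2r// gtn_eqF.
apply: ler_sum => i _; apply: ler_wpM2l; first exact: exprn_ge0.
by apply: lerXn2r; rewrite ?nnegrE// ltW.
Qed.

Lemma tie_win_ltr N x y y' : (0 < N)%N -> 0 <= x -> 0 <= y -> y < y' ->
  tie_win N x y < tie_win N x y'.
Proof.
move=> N0 x0 y0 yy'; rewrite /tie_win ltr_pM2l ?invr_gt0 ?ltr0n//.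
have y'0 : 0 <= y' by rewrite (le_trans y0)// ltW.
rewrite !big_ord_recl/= subn0 !mulr1 ltr_leD//.
  by rewrite ltrXn2r// gtn_eqF.
apply: ler_sum => i _; apply: ler_wpM2r; first exact: exprn_ge0.
by apply: lerXn2r; rewrite ?nnegrE// ltW.
Qed.

Lemma tie_win_ge0 N x y : 0 <= x -> 0 <= y -> 0 <= tie_win N x y.
Proof.
move=> x0 y0; rewrite mulr_ge0 ?invr_ge0//; apply: sumr_ge0 => i _.
by rewrite mulr_ge0 ?exprn_ge0.
Qed.

(** The recursion follows [expect_bids]: [c] opponents already drawn tie with the bid, and each of
    the [k] remaining ones bids below it with probability [x] or ties with probability [m]. Higher
    bids contribute zero. *)
Fixpoint tie_share k c x m : R :=
  if k is k'.+1 then x * tie_share k' c x m + m * tie_share k' c.+1 x m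
  else (c.+1%:R)^-1.

Lemma tie_share_ge0 k c x m : 0 <= x -> 0 <= m -> 0 <= tie_share k c x m.
Proof.
by move=> x0 m0; elim: k c => [|k IH] c /=; rewrite ?invr_ge0// addr_ge0// mulr_ge0.
Qed.

(* Integration by parts for [tie_share k c x m = \int_0^1 t^c (x + m t)^k dt]. *)
Lemma tie_share_parts k c x m :
  c.+1%:R * tie_share k.+1 c x m + k.+1%:R * m * tie_share k c.+1 x m =
  (x + m) ^+ k.+1.
Proof.
elim: k c => [|k IH] c.
  have c1 : c.+1%:R != 0 :> R by rewrite pnatr_eq0.
  have c2 : c.+2%:R != 0 :> R by rewrite pnatr_eq0.
  by rewrite /= expr1; field; rewrite nat1r c1 -natrD c2.
rewrite [RHS]exprS (mulrDl x m) -[in X in _ = X + _](IH c) -(IH c.+1).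
suff step A B D E : B = x * D + m * E ->
    c.+1%:R * (x * A + m * B) + k.+2%:R * m * B =
    x * (c.+1%:R * A + k.+1%:R * m * D) + m * (c.+2%:R * B + k.+1%:R * m * E).
  exact: step.
by move=> ->; ring.
Qed.

(** Both sides are [\int_0^1 (x + m t)^k dt], the mean of [s^k] over [[x, x + m]]. In the induction,
    [tie_share_parts] at [c = 0] rewrites the leading power of the sum. *)
Lemma tie_share_win k x m : tie_share k 0 x m = tie_win k x (x + m).
Proof.
suff : k.+1%:R * tie_share k 0 x m = \sum_(i < k.+1) (x + m) ^+ (k - i) * x ^+ i.
  by rewrite /tie_win => <-; rewrite mulrA mulVf ?mul1r// pnatr_eq0.
elim: k => [|k IH].
  by rewrite /= big_ord_recr/= big_ord0 invr1; ring.
have := tie_share_parts k 0 x m; rewrite mul1r => parts.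
rewrite big_ord_recl/= subn0 mulr1 -parts.
rewrite (eq_bigr (fun i : 'I_k.+1 => x * ((x + m) ^+ (k - i) * x ^+ i))); last first.
  by move=> i _; rewrite /bump/= add1n subSS exprS; ring.
rewrite -mulr_sumr -IH /= -[k.+2]addn1 natrD; ring.
Qed.

Lemma integral_step P p (A B : R) : 0 <= A -> 0 <= B ->
  (\int[P]_x (if x < p then A else if x == p then B else 0)%:E =
   (cdf_lt P p * A + (cdf_le P p - cdf_lt P p) * B)%:E)%E.
Proof.
move=> A0 B0.
pose I1 : set (measurableTypeR R) := `]-oo, p[%classic.
pose I2 : set (measurableTypeR R) := [set p].
have mI1 : measurable I1 by exact: measurable_itv.
have mI2 : measurable I2 by exact: measurable_set1.
transitivity (\int[P]_x (A%:E * (\1_I1 x)%:E + B%:E * (\1_I2 x)%:E))%E.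
  apply: eq_integral => x _; rewrite -!EFinM -EFinD; congr EFin.
  rewrite !indicE !mem_setE in_itv/=.
  have -> : (x \in I2) = (x == p) by apply/idP/eqP; rewrite inE.
  by case: ltgtP => _ /=; rewrite ?mulr1 ?mulr0 ?addr0 ?add0r.
have mi (I : set (measurableTypeR R)) : measurable I ->
    measurable_fun setT (EFin \o \1_I : measurableTypeR R -> \bar R).
  by move=> mI; exact/measurable_EFinP/measurable_indic.
rewrite ge0_integralD//=; last 4 first.
- by move=> x _; rewrite -EFinM lee_fin mulr_ge0// indicE.
- by apply: measurable_funeM; exact: mi.
- by move=> x _; rewrite -EFinM lee_fin mulr_ge0// indicE.
- by apply: measurable_funeM; exact: mi.
rewrite !ge0_integralZl//=; try exact: mi.
rewrite !integral_indic// !setIT.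
rewrite [X in (_ * X + _)%E](probE P mI1) [X in (_ + _ * X)%E](probE P mI2).
rewrite prob_set1 -!EFinM -EFinD; congr EFin.
by rewrite -[prob P I1]/(cdf_lt P p); ring.
Qed.

(** The law of one opponent's bid before his type is known. As a predicate, it lets the computations
    use [M] only through its values on measurable sets. *)
Definition mixture theta L H M := forall A : set (measurableTypeR R),
  measurable A -> prob M A = theta * prob L A + (1 - theta) * prob H A.

Lemma mixture_le theta L H M p : mixture theta L H M ->
  cdf_le M p = theta * cdf_le L p + (1 - theta) * cdf_le H p.
Proof. by apply; exact: measurable_itv. Qed.

Lemma mixture_lt theta L H M p : mixture theta L H M ->
  cdf_lt M p = theta * cdf_lt L p + (1 - theta) * cdf_lt H p.
Proof. by apply; exact: measurable_itv. Qed.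

(** The counter [c] makes the induction possible: each tie drawn leaves the list and is added to
    [c]. *)
Lemma expect_share theta L H M p k c : mixture theta L H M ->
  expect_bids theta L H k (fun s => (if all (fun q => q <= p) s
    then ((count_mem p s + c).+1%:R)^-1 else 0)%:E) =
  (tie_share k c (cdf_lt M p) (cdf_le M p - cdf_lt M p))%:E.
Proof.
move=> ML; have x0 := cdf_lt_ge0 M p.
have m0 : 0 <= cdf_le M p - cdf_lt M p by rewrite subr_ge0 cdf_lt_le.
elim: k c => [//|k IH] c /=; rewrite /expect_bid.
set A := tie_share k c _ _; set B := tie_share k c.+1 _ _.
pose f x := (if x < p then A else if x == p then B else 0)%:E.
have fE x : expect_bids theta L H k (fun s => (if (x <= p) && all (fun q => q <= p) s
    then (((x == p) + count_mem p s + c).+1%:R)^-1 else 0)%:E) = f x.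
  rewrite /f; case: ltgtP => xp /=.
  - by rewrite -IH.
  (* One bid above [p] makes the test fail whatever follows, so all remaining integrals are zero. *)
  - elim: (k) {IH A B f} => [//|j IHj] /=; rewrite /expect_bid.
    have h (P : strategy R) : (\int[P]_x0 expect_bids theta L H j (fun=> 0%:E) = 0)%E.
      by under eq_integral do rewrite IHj; rewrite integral0.
    by rewrite !h !mule0 adde0.
  - rewrite -IH; congr expect_bids; apply/funext => s.
    by rewrite addnAC add1n addnC -addSnnS addnC.
under eq_integral do rewrite fE.
under [X in (_ + _ * X)%E]eq_integral do rewrite fE.
rewrite !integral_step ?tie_share_ge0// -!EFinM -EFinD (mixture_le _ ML) (mixture_lt _ ML).
congr EFin; ring.
Qed.

Lemma win_probE theta L H M N p : mixture theta L H M ->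
  win_prob N.+1 theta L H p = (tie_win N (cdf_lt M p) (cdf_le M p))%:E.
Proof.
move=> ML; rewrite /win_prob /=.
have -> : (fun s => (share p s)%:E) = (fun s => (if all (fun q => q <= p) s
    then ((count_mem p s + 0).+1%:R)^-1 else 0)%:E).
  by apply/funext => s; rewrite /share addn0.
rewrite (expect_share _ _ _ ML) tie_share_win; congr (_ _ _)%:E; ring.
Qed.

Definition pay N M p : R := tie_win N (cdf_lt M p) (cdf_le M p) - p.

Lemma bid_payoffE theta L H M N p : mixture theta L H M ->
  bid_payoff N.+1 theta L H p = (pay N M p)%:E.
Proof. by move=> ML; rewrite /bid_payoff (win_probE _ _ ML). Qed.

Lemma measurable_win N M :
  measurable_fun setT (fun p : measurableTypeR R => tie_win N (cdf_lt M p) (cdf_le M p)).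
Proof.
apply: nondecreasing_measurable => //= p q pq.
by apply: tie_win_le; rewrite ?cdf_lt_ge0 ?cdf_le_ge0 ?cdf_lt_nd ?cdf_le_nd.
Qed.

Lemma measurable_pay N M : measurable_fun setT (pay N M : measurableTypeR R -> R).
Proof. by apply: measurable_funB; [exact: measurable_win|exact: measurable_id]. Qed.

End WinProbability.

(** * Integrals and best responses *)

Section Integrals.
Context {R : realType}.
Implicit Types (P L H M : strategy R) (p q x y m theta c u : R) (N k : nat).
Implicit Types (D : set (measurableTypeR R)) (f : measurableTypeR R -> R).

Lemma prob_integral_cst P u : (\int[P]_x u%:E = u%:E)%E.
Proof.
have := integral_cst P measurableT u%:E.
by rewrite [X in (_ * X)%E](@probability_setT _ _ _ P) mule1.
Qed.

Lemma full_ae P D (Q : R -> Prop) : measurable D -> prob P D = 1 ->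
  (forall x, D x -> Q x) -> {ae P, forall x, Q x}.
Proof.
move=> mD D1 DQ; exists (~` D); split; first exact: measurableC.
  by rewrite probability_setC// probE// D1 subee.
by move=> x /= nQ Dx; apply: nQ; exact: DQ.
Qed.

Lemma ae_full P D : measurable D -> {ae P, forall x, D x} -> prob P D = 1.
Proof.
move=> mD [A [mA A0 sub]]; apply/eqP; rewrite eq_le prob_le1//=.
have -> : 1 = prob P (~` A) by rewrite /prob probability_setC// A0 sube0.
apply: prob_mono => //; first exact: measurableC.
by move=> x nAx; apply: contrapT => /sub.
Qed.

Lemma integral_full_eq P D f g : measurable D -> prob P D = 1 ->
  measurable_fun setT f -> measurable_fun setT g -> (forall x, D x -> f x = g x) ->
  (\int[P]_x (f x)%:E = \int[P]_x (g x)%:E)%E.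
Proof.
move=> mD D1 mf mg fg; apply: ae_eq_integral => //.
- exact/measurable_EFinP.
- exact/measurable_EFinP.
- by apply: (full_ae mD D1) => x Dx _; rewrite fg.
Qed.

Lemma integral_full_cst P D f u : measurable D -> prob P D = 1 ->
  measurable_fun setT f -> (forall x, D x -> f x = u) ->
  (\int[P]_x (f x)%:E = u%:E)%E.
Proof.
move=> mD D1 mf fu; rewrite (integral_full_eq mD D1 mf (g := cst u))//.
exact: prob_integral_cst.
Qed.

Lemma full_bounded_integrable P D f (K : R) : measurable D -> prob P D = 1 ->
  measurable_fun setT f -> (forall x, D x -> `|f x| <= K) ->
  P.-integrable setT (EFin \o f).
Proof.
move=> mD D1 mf fK; apply/integrableP; split; first exact/measurable_EFinP.
rewrite (@le_lt_trans _ _ (\int[P]_x (K%:E)))%E//; last first.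
  by rewrite prob_integral_cst ltry.
have K0 : 0 <= K.
  apply: contrapT => /negP; rewrite -ltNge => K0.
  have D0 : D = set0.
    by rewrite -subset0 => x /fK /(le_trans (normr_ge0 _)); rewrite leNgt K0.
  by move: D1; rewrite D0 /prob measure0 /= => /eqP; rewrite eq_sym oner_eq0.
apply: ae_ge0_le_integral => //.
- by apply: measurableT_comp => //; exact/measurable_EFinP.
- by apply: (full_ae mD D1) => x Dx _; rewrite /= lee_fin fK.
Qed.

(** Pointwise form of a best response: the payoff [u] is attained by almost every bid drawn, not
    merely on average. *)
Definition best P c f u := [/\ prob P `[0, c]%classic = 1,
  forall p, 0 <= p <= c -> f p <= u &
  prob P (`[0, c]%classic `&` [set p | f p = u]) = 1].

Lemma measurable_level f u : measurable_fun setT f -> measurable [set p | f p = u].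
Proof.
move=> mf; rewrite (_ : [set _ | _] = f @^-1` [set u])//.
by rewrite -[X in measurable X]setTI; exact: mf.
Qed.

Lemma integral_best P c f u : measurable_fun setT f -> best P c f u ->
  (\int[P]_x (f x)%:E = u%:E)%E.
Proof.
move=> mf [_ _ u1]; apply: (integral_full_cst _ u1) => //.
  by apply: measurableI; [exact: measurable_itv|exact: measurable_level].
by move=> x [].
Qed.

(** With [u] the expected payoff, [u - f] is nonnegative on [[0, c]] and has integral zero, so it
    vanishes almost everywhere. The bound [K] provides integrability. *)
Lemma best_integral P c f (K : R) : measurable_fun setT f ->
  prob P `[0, c]%classic = 1 -> (forall p, 0 <= p <= c -> `|f p| <= K) ->
  (forall p, 0 <= p <= c -> ((f p)%:E <= \int[P]_x (f x)%:E)%E) ->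
  exists u, best P c f u.
Proof.
set D : set (measurableTypeR R) := `[0, c]%classic.
have mD : measurable D by exact: measurable_itv.
move=> mf D1 fK fle.
have fi : P.-integrable setT (EFin \o f).
  by apply: (full_bounded_integrable mD D1 mf (K := K)) => x; rewrite /D/= in_itv/=; exact: fK.
pose u := fine (\int[P]_x (f x)%:E)%E.
have uE : (\int[P]_x (f x)%:E = u%:E)%E by rewrite fineK//; exact: integrable_fin_num.
have fu p : 0 <= p <= c -> f p <= u by move=> /fle; rewrite uE lee_fin.
exists u; split=> //.
have mu : measurable [set p | f p = u] by exact: measurable_level.
rewrite prob_full_setI//.
pose g : measurableTypeR R -> R := fun x => (u - f x).
have mg : measurable_fun setT g by apply: measurable_funB.
have g0 : (\int[P]_x (g x)%:E = 0)%E.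
  under eq_integral do rewrite /g EFinB.
  rewrite (@integralB _ _ _ P _ measurableT (EFin \o cst u) (EFin \o f))//=.
    by rewrite prob_integral_cst uE -EFinB subrr.
  by apply: (full_bounded_integrable mD D1 (K := `|u|)).
have : ae_eq P setT (EFin \o g) (cst 0%E).
  apply/ae_eq_integral_abs => //; first exact/measurable_EFinP.
  rewrite -[RHS]g0; apply: (integral_full_eq mD D1 (f := fun x => `|g x|)) => //.
    exact: measurableT_comp.
  by move=> x; rewrite /D/= in_itv/= => /fu xu; rewrite ger0_norm// subr_ge0.
move=> h; apply: ae_full => //; apply: filterS h => x /(_ I) [] /eqP.
by rewrite subr_eq0 => /eqP.
Qed.

Lemma mixture_exists theta L H : 0 <= theta <= 1 ->
  exists2 M, mixture theta L H M &
    forall f : measurableTypeR R -> \bar R, measurable_fun setT f ->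
      (forall x, 0 <= f x)%E ->
      (\int[M]_x f x = theta%:E * \int[L]_x f x + (1 - theta)%:E * \int[H]_x f x)%E.
Proof.
move=> /andP[t0 t1]; have t1' : 0 <= 1 - theta by rewrite subr_ge0.
pose m := measure_add (mscale (NngNum t0) L) (mscale (NngNum t1') H).
have mE A : m A = (theta%:E * L A + (1 - theta)%:E * H A)%E by rewrite /m measure_addE.
have m1 : m setT = 1%E.
  by rewrite mE !probability_setT !mule1 -EFinD addrC subrK.
(* Normalizing changes no value, since [m] has mass one; it only supplies the probability structure
   that [strategy] requires. [L] is the fallback argument of [mnormalize]. *)
pose M : strategy R := mnormalize m L.
have norm (mu : {measure set (measurableTypeR R) -> \bar R}) A :
    mu setT = 1%E -> mnormalize mu L A = mu A.
  by move=> mu1; rewrite /mnormalize mu1 onee_eq0 /= invr1 mule1.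
have ME A : M A = m A by exact: norm.
exists M.
  by move=> A mA; apply: EFin_inj; rewrite -probE// ME mE !probE// -!EFinM -EFinD.
move=> f mf f0.
rewrite (eq_measure_integral m); last by move=> A _ _; exact: ME.
rewrite [LHS]ge0_integral_measure_add//.
by rewrite !ge0_integral_mscale.
Qed.

End Integrals.

(** * Winning probabilities add up to one *)

Section Winners.
Context {R : realType}.
Implicit Types (P L H M : strategy R) (x y theta c : R) (N k : nat).
Implicit Types (D : set (measurableTypeR R)).

Lemma integral_indic_prob P D : measurable D ->
  (\int[P]_x (\1_D x)%:E = (prob P D)%:E)%E.
Proof. by move=> mD; rewrite integral_indic// setIT; exact: probE. Qed.

(* By induction on [N], exchanging the order of integration over two bids
   [y <= x]; this is the chain rule for the [N.+1]-st power of a cdf with atoms. *)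
Lemma integral_tie_win_down M N D : measurable D ->
  (forall x y, D x -> y <= x -> D y) ->
  (\int[M]_x (\1_D x * (N.+1%:R * tie_win N (cdf_lt M x) (cdf_le M x)))%:E =
   (prob M D ^+ N.+1)%:E)%E.
Proof.
pose G k x := k.+1%:R * tie_win k (cdf_lt M x) (cdf_le M x).
(* [G k] is the divided difference of the power [k.+1]; this recursion is its product rule. *)
have GS k x : G k.+1 x = cdf_le M x * G k x + cdf_lt M x ^+ k.+1.
  have GE j : G j x = \sum_(i < j.+1) cdf_le M x ^+ (j - i) * cdf_lt M x ^+ i.
    by rewrite /G /tie_win mulrA divff ?pnatr_eq0// mul1r.
  rewrite !GE big_ord_recr/= subnn expr0 mul1r mulr_sumr.
  congr (_ + _); apply: eq_bigr => i _.
  by rewrite mulrA -exprS subSn// -ltnS.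
have G0 k x : 0 <= G k x by rewrite mulr_ge0// tie_win_ge0 ?cdf_lt_ge0 ?cdf_le_ge0.
have mG k : measurable_fun setT (G k : measurableTypeR R -> R).
  by apply: measurable_funM => //; exact: measurable_win.
have m1 E : measurable E -> measurable_fun setT (\1_E : measurableTypeR R -> R).
  by move=> mE; exact: measurable_indic.
have mle : measurable_fun setT (cdf_le M : measurableTypeR R -> R).
  by apply: nondecreasing_measurable => // p q; exact: cdf_le_nd.
have mlt : measurable_fun setT (cdf_lt M : measurableTypeR R -> R).
  by apply: nondecreasing_measurable => // p q; exact: cdf_lt_nd.
have ind0 E x : 0 <= (\1_E x : R) by rewrite indicE.
elim: N D => [|N IH] D mD dD.
  under eq_integral => x _.
    rewrite /tie_win big_ord_recr big_ord0/= add0r subnn !expr0 !mulr1 divff// mulr1.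
    over.
  by rewrite expr1; exact: integral_indic_prob.
have lt_down y : forall x z, `]-oo, y[%classic x -> z <= x -> `]-oo, y[%classic z.
  by move=> x z /=; rewrite !in_itv/= => xy zx; exact: le_lt_trans zx xy.
(* Integrating [K] over [y] first gives the term [cdf_le M x * G N x] of the recursion. Integrating
   over [x] first leaves the part of [D] not below [y], a difference of two instances of the
   induction hypothesis, for [D] and for []-oo, y[]; this is why the statement covers every downward
   closed set. *)
pose K (z : measurableTypeR R * measurableTypeR R) : R :=
  \1_D z.1 * G N z.1 * \1_[set w : measurableTypeR R * measurableTypeR R | w.2 <= w.1] z.
have mK : measurable_fun setT K.
  apply: measurable_funM; first apply: measurable_funM.
  - exact: (measurableT_comp (m1 _ mD) measurable_fst).
  - exact: (measurableT_comp (mG N) measurable_fst).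
  - apply: measurable_indic; rewrite -[X in measurable X]setTI.
    rewrite (_ : [set _ | _] = (fun w : measurableTypeR R * measurableTypeR R =>
      (w.2 : R) <= w.1) @^-1` [set true])//.
    exact: measurable_fun_ler.
have KE (x y : R) : K (x, y) = \1_D x * G N x * (y <= x)%R%:R.
  rewrite /K indicE; congr (_ * (nat_of_bool _)%:R).
  by apply/idP/idP; rewrite inE.
have indle (x y : R) : (\1_(`]-oo, x]%classic) y : R) = (y <= x)%R%:R.
  rewrite indicE; congr (nat_of_bool _)%:R.
  by apply/idP/idP; rewrite inE/= in_itv.
have indlt (x y : R) : (\1_(`]-oo, x[%classic) y : R) = (y < x)%R%:R.
  rewrite indicE; congr (nat_of_bool _)%:R.
  by apply/idP/idP; rewrite inE/= in_itv.
have K0 z : 0 <= K z by apply: mulr_ge0; [apply: mulr_ge0|rewrite indicE].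
have KF (x : R) : (\int[M]_y (K (x, y))%:E = (\1_D x * (cdf_le M x * G N x))%:E)%E.
  transitivity (\int[M]_y ((\1_D x * G N x)%:E * (\1_(`]-oo, x]%classic) y)%:E))%E.
    by apply: eq_integral => y _; rewrite -EFinM KE indle.
  rewrite ge0_integralZl//=; last 2 first.
  - by apply/measurable_EFinP; exact: m1.
  - by rewrite lee_fin mulr_ge0.
  rewrite integral_indic_prob// -EFinM -[prob M _]/(cdf_le M x); congr EFin; ring.
have KG (y : R) : (\int[M]_x (K (x, y))%:E =
    (\1_D y * (prob M D ^+ N.+1 - cdf_lt M y ^+ N.+1))%:E)%E.
  have [yD|nyD] := pselect (D y); last first.
    rewrite [in RHS]indicE memNset// mul0r integral0_eq// => x _; rewrite KE indicE.
    case: (pselect (D x)) => [xD|nxD]; last by rewrite memNset// !mul0r.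
    have [yx|xy] := leP y x; last by rewrite mulr0.
    by exfalso; apply: nyD; exact: dD yx.
  have ID : (\int[M]_x (\1_D x * G N x)%:E = (prob M D ^+ N.+1)%:E)%E by exact: IH.
  have Iy : (\int[M]_x (\1_(`]-oo, y[%classic) x * G N x)%:E = (cdf_lt M y ^+ N.+1)%:E)%E.
    by apply: IH => //; exact: lt_down.
  have : (\int[M]_x (\1_D x * G N x)%:E =
      \int[M]_x ((K (x, y))%:E + (\1_(`]-oo, y[%classic) x * G N x)%:E))%E.
    apply: eq_integral => x _; rewrite -EFinD; congr EFin; rewrite KE indlt.
    have [yx|xy] := leP y x; first by rewrite mulr1 mul0r addr0.
    by rewrite mulr0 add0r indicE mem_set// ?mul1r//; exact: dD yD (ltW xy).
  rewrite ge0_integralD//=; last 4 first.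
  - by move=> x _; rewrite lee_fin.
  - apply/measurable_EFinP; exact: (measurableT_comp mK (measurable_pair2 y)).
  - by move=> x _; rewrite lee_fin mulr_ge0.
  - by apply/measurable_EFinP; apply: measurable_funM => //; exact: m1.
  rewrite ID Iy => IK.
  by rewrite [in RHS]indicE mem_set// mul1r EFinB IK addeK.
(* The other term of the recursion, [cdf_lt M x ^+ N.+1], will cancel the power subtracted in
   [KG]. *)
under eq_integral => x _ do rewrite -/(G N.+1 x) GS mulrDr EFinD.
rewrite ge0_integralD//=; last 4 first.
- by move=> x _; rewrite lee_fin; apply: mulr_ge0 => //; apply: mulr_ge0 => //; exact: cdf_le_ge0.
- by apply/measurable_EFinP; do 2 apply: measurable_funM => //; exact: m1.
- by move=> x _; rewrite lee_fin; apply: mulr_ge0 => //; apply: exprn_ge0; exact: cdf_lt_ge0.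
- by apply/measurable_EFinP; apply: measurable_funM; [exact: m1|exact: measurable_funX].
under eq_integral do rewrite -KF.
have mEK : measurable_fun setT (EFin \o K) by exact/measurable_EFinP.
have EK0 z : (0 <= (EFin \o K) z)%E by rewrite lee_fin.
rewrite (fubini_tonelli _ mEK EK0) /=.
under eq_integral do rewrite KG.
rewrite -ge0_integralD//=; last 4 first.
- move=> x _; rewrite lee_fin indicE.
  have [xD|nxD] := pselect (D x); last by rewrite memNset// mul0r.
  rewrite mulr_ge0// subr_ge0 lerXn2r ?nnegrE ?cdf_lt_ge0 ?prob_ge0//.
  apply: prob_mono => // z /=; rewrite in_itv/= => /ltW; exact: dD xD.
- apply/measurable_EFinP; apply: measurable_funM; first exact: m1.
  by apply: measurable_funB => //; exact: measurable_funX.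
- by move=> x _; rewrite lee_fin; apply: mulr_ge0 => //; apply: exprn_ge0; exact: cdf_lt_ge0.
- by apply/measurable_EFinP; apply: measurable_funM; [exact: m1|exact: measurable_funX].
under eq_integral do rewrite -EFinD -mulrDr subrK mulrC EFinM.
rewrite ge0_integralZl//=; last 2 first.
- by apply/measurable_EFinP; exact: m1.
- by rewrite lee_fin exprn_ge0// prob_ge0.
by rewrite integral_indic_prob// -EFinM -exprSr.
Qed.

End Winners.

(** * Expected revenue, and equilibria as pairs of best responses *)

Section Revenue.
Context {R : realType}.
Implicit Types (P L H M : strategy R) (x y theta b c u : R) (N k : nat).

(** Among [N.+1] bidders drawing independently from [M], each wins equally often. *)
Lemma integral_tie_win M N :
  (\int[M]_x (tie_win N (cdf_lt M x) (cdf_le M x))%:E = (N.+1%:R^-1)%:E)%E.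
Proof.
have n0 : N.+1%:R != 0 :> R by rewrite pnatr_eq0.
have := integral_tie_win_down M N measurableT (fun _ _ _ _ => I).
rewrite /prob (@probability_setT _ _ _ M) expr1n => h.
transitivity (\int[M]_x ((N.+1%:R^-1)%:E * (\1_setT x *
    (N.+1%:R * tie_win N (cdf_lt M x) (cdf_le M x)))%:E))%E.
  apply: eq_integral => x _; rewrite indicE in_setT mul1r -EFinM mulrA mulVf ?mul1r//.
rewrite ge0_integralZl//=.
- by rewrite h mule1.
- apply/measurable_EFinP; apply: measurable_funM; first exact: measurable_indic.
  by apply: measurable_funM => //; exact: measurable_win.
- move=> x _; rewrite lee_fin indicE in_setT mul1r.
  by rewrite mulr_ge0// tie_win_ge0 ?cdf_lt_ge0 ?cdf_le_ge0.
Qed.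

Lemma integral_translate P c u : P.-integrable setT (EFin \o (idfun : measurableTypeR R -> R)) ->
  (\int[P]_x x%:E = u%:E)%E -> (\int[P]_x (c + x)%:E = (c + u)%:E)%E.
Proof.
move=> iP Pu; under eq_integral do rewrite EFinD.
rewrite (@integralD_EFin _ _ _ P _ measurableT (cst c) (idfun : measurableTypeR R -> R))//=.
- by rewrite prob_integral_cst Pu -EFinD.
- apply: (full_bounded_integrable measurableT (K := `|c|)) => //.
  by rewrite /prob (@probability_setT _ _ _ P).
Qed.

Lemma expect_bids_sum theta L H k c l h :
  L.-integrable setT (EFin \o (idfun : measurableTypeR R -> R)) ->
  H.-integrable setT (EFin \o (idfun : measurableTypeR R -> R)) ->
  (\int[L]_x x%:E = l%:E)%E -> (\int[H]_x x%:E = h%:E)%E ->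
  expect_bids theta L H k (fun s => (c + \sum_(x <- s) x)%:E) =
  (c + k%:R * (theta * l + (1 - theta) * h))%:E.
Proof.
move=> iL iH Ll Hh; elim: k c => [|k IH] c /=; first by rewrite big_nil mul0r.
set e := theta * l + (1 - theta) * h.
have step x : expect_bids theta L H k (fun s => (c + \sum_(y <- x :: s) y)%:E) =
    (c + k%:R * e + x)%:E.
  rewrite addrAC -IH; congr expect_bids; apply/funext => s.
  by rewrite big_cons addrA.
rewrite /expect_bid.
under eq_integral do rewrite step.
under [X in (_ + _ * X)%E]eq_integral do rewrite step.
rewrite (integral_translate _ iL Ll) (integral_translate _ iH Hh) -!EFinM -EFinD.
by congr EFin; rewrite /e -[k.+1]addn1 natrD; ring.
Qed.

(** At payoff zero, almost every bid equals its own winning probability, so the two have the same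
    mean. *)
Lemma best_bid_integral P M N c : best P c (pay N M) 0 -> exists l,
  [/\ P.-integrable setT (EFin \o (idfun : measurableTypeR R -> R)),
      (\int[P]_x x%:E = l%:E)%E &
      (\int[P]_x (tie_win N (cdf_lt M x) (cdf_le M x))%:E = l%:E)%E].
Proof.
move=> [P1 _ P2].
have iP : P.-integrable setT (EFin \o (idfun : measurableTypeR R -> R)).
  have cb x : `[0, c]%classic x -> `|x| <= c.
    by rewrite /= in_itv/= => /andP[x0 xc]; rewrite ger0_norm.
  by apply: (full_bounded_integrable _ P1 _ cb) => //; exact: measurable_itv.
have fl : (\int[P]_x x%:E = (fine (\int[P]_x x%:E))%:E)%E.
  by rewrite fineK//; exact: integrable_fin_num iP.
exists (fine (\int[P]_x x%:E))%E; split=> //.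
rewrite -fl; apply: (integral_full_eq _ P2).
- apply: measurableI; first exact: measurable_itv.
  by apply: measurable_level; exact: measurable_pay.
- exact: measurable_win.
- exact: measurable_id.
- by move=> x [_] /eqP; rewrite /pay subr_eq0 => /eqP.
Qed.

Lemma revenue_full_extraction N theta b L H M : 0 <= theta <= 1 -> mixture theta L H M ->
  best L b (pay N M) 0 -> best H 1 (pay N M) 0 -> revenue N.+1 theta L H = 1%E.
Proof.
move=> t01 ML bL bH.
(* The splitting of integrals by type comes with this particular mixture; any mixture has the same
   cdfs, so the winning probabilities agree. *)
have [M' ML' intM] := mixture_exists L H t01.
have MM' x : (cdf_lt M x = cdf_lt M' x) * (cdf_le M x = cdf_le M' x).
  by rewrite !(mixture_lt _ ML) !(mixture_le _ ML) !(mixture_lt _ ML') !(mixture_le _ ML').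
have [l [iL Ll Lw]] := best_bid_integral bL.
have [h [iH Hh Hw]] := best_bid_integral bH.
rewrite /revenue.
have -> : (fun s : seq R => (\sum_(x <- s) x)%:E) = (fun s => (0 + \sum_(x <- s) x)%:E).
  by apply/funext => s; rewrite add0r.
rewrite (expect_bids_sum _ _ _ iL iH Ll Hh) add0r.
have : (\int[M']_x (tie_win N (cdf_lt M x) (cdf_le M x))%:E = (N.+1%:R^-1)%:E)%E.
  by rewrite -(integral_tie_win M'); apply: eq_integral => x _; rewrite !MM'.
rewrite intM; last 2 first.
- by apply/measurable_EFinP; exact: measurable_win.
- by move=> x; rewrite lee_fin tie_win_ge0 ?cdf_lt_ge0 ?cdf_le_ge0.
rewrite Lw Hw -!EFinM -EFinD => -[->].
by rewrite divff// pnatr_eq0.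
Qed.

Lemma pay_bound N M c p : 0 <= p <= c -> `|pay N M p| <= 1 + c.
Proof.
move=> /andP[p0 pc]; apply: (le_trans (ler_normB _ _)); rewrite (ger0_norm p0).
apply: lerD => //; rewrite ger0_norm ?tie_win_ge0 ?cdf_lt_ge0 ?cdf_le_ge0//.
rewrite -(expr1n _ N) -tie_win_id.
apply: tie_win_le; rewrite ?cdf_lt_ge0 ?cdf_le_ge0 ?cdf_le_le1//.
exact: le_trans (cdf_lt_le _ _) (cdf_le_le1 _ _).
Qed.

(** This lemma and [best_equilibrium] translate between equilibria and pairs of [best] statements,
    the form used in the rest of the argument. *)
Lemma equilibrium_best N theta b L H M : mixture theta L H M ->
  symmetric_equilibrium N.+1 theta b L H ->
  exists ul uh, [/\ u_low N.+1 theta L H = ul%:E, u_high N.+1 theta L H = uh%:E,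
    best L b (pay N M) ul & best H 1 (pay N M) uh].
Proof.
move=> ML [Lb H1 bl bh].
have E (P : strategy R) : (\int[P]_p bid_payoff N.+1 theta L H p = \int[P]_p (pay N M p)%:E)%E.
  by apply: eq_integral => p _; exact: bid_payoffE.
have [ul bul] : exists u, best L b (pay N M) u.
  apply: (best_integral (measurable_pay N M) (K := 1 + b)).
  - by rewrite /prob Lb.
  - exact: pay_bound.
  - by move=> p /bl; rewrite (bid_payoffE _ _ ML) /u_low E.
have [uh buh] : exists u, best H 1 (pay N M) u.
  apply: (best_integral (measurable_pay N M) (K := 1 + 1)).
  - by rewrite /prob H1.
  - exact: pay_bound.
  - by move=> p /bh; rewrite (bid_payoffE _ _ ML) /u_high E.
exists ul, uh; split=> //.
- by rewrite /u_low E (integral_best _ bul)//; exact: measurable_pay.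
- by rewrite /u_high E (integral_best _ buh)//; exact: measurable_pay.
Qed.

Lemma best_equilibrium N theta b L H M ul uh : mixture theta L H M ->
  best L b (pay N M) ul -> best H 1 (pay N M) uh ->
  symmetric_equilibrium N.+1 theta b L H.
Proof.
move=> ML bul buh.
have E (P : strategy R) : (\int[P]_p bid_payoff N.+1 theta L H p = \int[P]_p (pay N M p)%:E)%E.
  by apply: eq_integral => p _; exact: bid_payoffE.
split.
- by rewrite probE; [case: bul => ->|exact: measurable_itv].
- by rewrite probE; [case: buh => ->|exact: measurable_itv].
- move=> p pb; rewrite (bid_payoffE _ _ ML) /u_low E (integral_best _ bul) ?lee_fin.
    by case: bul => _ + _; exact.
  exact: measurable_pay.
- move=> p pb; rewrite (bid_payoffE _ _ ML) /u_high E (integral_best _ buh) ?lee_fin.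
    by case: buh => _ + _; exact.
  exact: measurable_pay.
Qed.

End Revenue.

(** * Structure of equilibria *)

Section Equilibrium.
Context {R : realType}.
Implicit Types (P L H M : strategy R) (p q t x y theta b c u : R) (N k : nat).

Lemma best_ge0 N M P c u : 0 <= c -> best P c (pay N M) u -> 0 <= u.
Proof.
move=> c0 [_ /(_ 0) + _]; rewrite lexx c0 => /(_ isT); apply: le_trans.
by rewrite /pay subr0 tie_win_ge0 ?cdf_lt_ge0 ?cdf_le_ge0.
Qed.

Lemma best_nonempty N M P c u : best P c (pay N M) u ->
  exists2 t, 0 <= t <= c & pay N M t = u.
Proof.
move=> [_ _ P1]; apply: contrapT => h.
move: P1; rewrite (_ : _ `&` _ = set0).
  by rewrite /prob measure0 => /esym/eqP; rewrite oner_eq0.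
rewrite -subset0 => t [/=]; rewrite in_itv/= => tc tu.
by apply: h; exists t.
Qed.

Lemma deviate_up N M P c u p : best P c (pay N M) u -> 0 <= p < c ->
  cdf_le M p ^+ N <= u + p.
Proof.
move=> [_ Pu _] /andP[p0 pc].
have up q : p < q -> q <= c -> cdf_le M p ^+ N <= u + q.
  move=> pq qc.
  have := Pu q; rewrite qc (ltW (le_lt_trans p0 pq)) => /(_ isT).
  rewrite /pay lerBlDr; apply: le_trans.
  rewrite -tie_win_id; apply: tie_win_le; rewrite ?cdf_le_ge0 ?cdf_le_lt//.
  exact: cdf_le_nd (ltW pq).
rewrite leNgt; apply/negP => lt.
(* The midpoint of [p] and [cdf_le M p ^+ N - u] is a bid above [p] that would earn more than [u].
   If it is not below the cap, bidding [c] already earns too much. *)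
have [h|h] := leP c ((p + (cdf_le M p ^+ N - u)) / 2).
  have := up c pc (lexx c); lra.
have := up ((p + (cdf_le M p ^+ N - u)) / 2); lra.
Qed.

Lemma tie_win_leX N M p : tie_win N (cdf_lt M p) (cdf_le M p) <= cdf_le M p ^+ N.
Proof. by rewrite -[leRHS]tie_win_id tie_win_le ?cdf_lt_ge0 ?cdf_le_ge0 ?cdf_lt_le. Qed.

Lemma tie_win_no_atom N M p : (0 < N)%N ->
  cdf_le M p ^+ N <= tie_win N (cdf_lt M p) (cdf_le M p) -> cdf_lt M p = cdf_le M p.
Proof.
move=> N0 h; apply/eqP; rewrite eq_le cdf_lt_le/= leNgt; apply/negP => lt.
have := tie_win_ltl N0 (cdf_lt_ge0 M p) (cdf_le_ge0 M p) lt.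
by rewrite tie_win_id ltNge h.
Qed.

Lemma typical_bid N M P c u p : (0 < N)%N -> best P c (pay N M) u -> 0 <= p < c ->
  pay N M p = u -> cdf_lt M p = cdf_le M p /\ cdf_le M p ^+ N = u + p.
Proof.
move=> N0 bP pc pu; have dev := deviate_up bP pc.
have wu : tie_win N (cdf_lt M p) (cdf_le M p) = u + p.
  by rewrite -pu /pay subrK.
split; first by apply: (tie_win_no_atom N0); rewrite wu.
by apply/eqP; rewrite eq_le dev -wu tie_win_leX.
Qed.

(** Overbidding is infeasible at the cap, so [deviate_up] does not apply. Instead the squeeze closes
    because the budget equals the value: [cdf_le M 1 ^+ N <= 1 <= u + 1]. *)
Lemma typical_top N M P u : (0 < N)%N -> best P 1 (pay N M) u ->
  pay N M 1 = u -> cdf_lt M 1 = cdf_le M 1 /\ cdf_le M 1 ^+ N = u + 1.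
Proof.
move=> N0 bP pu; have u0 := best_ge0 ler01 bP.
have F1 : cdf_le M 1 ^+ N <= 1 by rewrite exprn_ile1 ?cdf_le_ge0 ?cdf_le_le1.
have wu : tie_win N (cdf_lt M 1) (cdf_le M 1) = u + 1.
  by rewrite -pu /pay subrK.
have := tie_win_leX N M 1; rewrite wu => uF.
split; first by apply: (tie_win_no_atom N0); rewrite wu (le_trans F1)// lerDr.
by apply/eqP; rewrite eq_le uF andbT (le_trans F1)// lerDr.
Qed.

(* [q] is the infimum of the bids of [T] above [p]: no mass lies between. *)
Lemma next_bid N M P (T : set (measurableTypeR R)) p c u : measurable T ->
  prob P T = 1 -> p < c -> cdf_le P p < cdf_lt P c ->
  (forall t, T t -> p < t < c ->
     cdf_lt P t = cdf_le P t /\ u + t <= cdf_le M t ^+ N) ->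
  exists q, [/\ p <= q < c, cdf_le P q = cdf_le P p & u + q <= cdf_le M q ^+ N].
Proof.
move=> mT T1 pc Ppc hT.
pose S : set R := [set t | T t /\ p < t < c].
have [s [Ts psc]] : S !=set0.
  apply: contrapT => /nonemptyPn S0.
  have : prob P (T `&` `]p, c[%classic) = 0.
    by rewrite (_ : _ `&` _ = set0) /prob ?measure0//.
  by rewrite prob_full_setI// prob_itvoo// => /eqP; rewrite subr_eq0 gt_eqF.
have lbS : lbound S p by move=> t [_ /andP[/ltW]].
have infS : has_inf S by split; [exists s|exists p].
have pq : p <= inf S by apply: lb_le_inf => //; exists s.
have qs t : S t -> inf S <= t by apply: ge_inf; exists p.
have qc : inf S < c.
  by apply: le_lt_trans (qs s _) _ => //; case/andP: psc.
exists (inf S); split; first by rewrite pq.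
  have [->//|qp] := eqVneq (inf S) p.
  have {pq}pq : p < inf S by rewrite lt_neqAle eq_sym qp.
  have lt_q : cdf_lt P (inf S) = cdf_le P p.
    apply/eqP; rewrite -subr_eq0 -prob_itvoo//.
    rewrite -(prob_full_setI _ _ T1)// (_ : _ `&` _ = set0) /prob ?measure0//.
    rewrite -subset0 => t [Tt]/=; rewrite in_itv/= => /andP[pt tq].
    have : S t by split => //; rewrite pt (lt_trans tq).
    by move/qs; rewrite leNgt tq.
  (* If the infimum belongs to [T] it is no atom by [hT]; if not, it has no mass because [T] has
     full probability. *)
  rewrite -lt_q; have [Tq|nTq] := pselect (T (inf S)).
    by have [|<-] := hT _ Tq; rewrite ?pq.
  apply/eqP; rewrite -subr_eq0 -prob_set1.
  rewrite -(prob_full_setI _ _ T1)//.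
  rewrite (_ : _ `&` _ = set0) /prob ?measure0//.
  by rewrite -subset0 => t [Tt]/= tq; apply: nTq; rewrite -tq.
apply: cdf_le_rc => t qt.
have [r Sr rt] := inf_lt infS.1 qt.
have [Tr prc] := Sr; have [_ ur] := hT _ Tr prc.
apply: le_trans (_ : u + r <= _); first by rewrite lerD2l qs.
apply: le_trans ur _; apply: lerXn2r; rewrite ?nnegrE ?cdf_le_ge0//.
exact: cdf_le_nd (ltW rt).
Qed.

Lemma cdf_lt_out P p c : prob P `[0, c]%classic = 1 -> p <= 0 -> cdf_lt P p = 0.
Proof.
move=> P1 p0; apply/eqP; rewrite eq_le cdf_lt_ge0 andbT; apply: cdf_lt_lc => t tp.
have P1' : P `[0, c]%classic = 1%E by rewrite probE ?P1//; exact: measurable_itv.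
have [out _] := cdf_le_out t P1'.
by rewrite out// (lt_le_trans tp).
Qed.

Lemma cdf_le_full P p a c : prob P `[a, c]%classic = 1 -> c <= p -> cdf_le P p = 1.
Proof.
move=> P1 cp.
have P1' : P `[a, c]%classic = 1%E by rewrite probE ?P1//; exact: measurable_itv.
by have [_ ->] := cdf_le_out p P1'.
Qed.

Section Profile.
Context (N : nat) (theta b : R) (L H M : strategy R) (ul uh : R).
Context (N0 : (0 < N)%N) (b01 : 0 < b < 1) (t01 : 0 <= theta < 1).
Context (ML : mixture theta L H M).
Context (bL : best L b (pay N M) ul) (bH : best H 1 (pay N M) uh).

Let TH : set (measurableTypeR R) := `[0, 1]%classic `&` [set p | pay N M p = uh].
Let TL : set (measurableTypeR R) := `[0, b]%classic `&` [set p | pay N M p = ul].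

Let mTH : measurable TH.
Proof.
apply: measurableI; first exact: measurable_itv.
by apply: measurable_level; exact: measurable_pay.
Qed.

Let mTL : measurable TL.
Proof.
apply: measurableI; first exact: measurable_itv.
by apply: measurable_level; exact: measurable_pay.
Qed.

Lemma cdf_le_low p : b <= p -> cdf_le L p = 1.
Proof. by move=> bp; have [L1 _ _] := bL; exact: (cdf_le_full L1). Qed.

Lemma cdf_le_high p : 1 <= p -> cdf_le H p = 1.
Proof. by move=> bp; have [H1 _ _] := bH; exact: (cdf_le_full H1). Qed.

Let typical_high t : TH t -> cdf_lt M t = cdf_le M t /\ cdf_le M t ^+ N = uh + t.
Proof.
move=> [/=]; rewrite in_itv/= => /andP[t0]; rewrite le_eqVlt => /predU1P[->|t1] tu.
  exact: (typical_top N0 bH).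
by apply: (typical_bid N0 bH) => //; rewrite t0.
Qed.

Let typical_low t : TL t -> t < b -> cdf_lt M t = cdf_le M t /\ cdf_le M t ^+ N = ul + t.
Proof.
move=> [/=]; rewrite in_itv/= => /andP[t0 _] tu tb.
by apply: (typical_bid N0 bL) => //; rewrite t0.
Qed.

(** At an optimal bid [M] has no atom, and since [1 - theta > 0] neither has [H]. A bid outside [TH]
    has probability zero under [H] anyway. *)
Lemma high_no_atom p : cdf_lt H p = cdf_le H p.
Proof.
have [_ _ H1] := bH.
apply/eqP; rewrite eq_sym -subr_eq0 -prob_set1; apply/eqP.
have [Tp|nTp] := pselect (TH p); last first.
  rewrite -(prob_full_setI _ _ H1)// (_ : _ `&` _ = set0) /prob ?measure0//.
  by rewrite -subset0 => t [Tt]/= tp; apply: nTp; rewrite -tp.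
have [+ _] := typical_high Tp; rewrite (mixture_lt _ ML) (mixture_le _ ML) prob_set1.
have := cdf_lt_le L p; have := cdf_lt_le H p; case/andP: t01; nra.
Qed.

Lemma low_no_atom p : 0 < theta -> p < b -> cdf_lt L p = cdf_le L p.
Proof.
move=> t0 pb; have [_ _ L1] := bL.
apply/eqP; rewrite eq_sym -subr_eq0 -prob_set1; apply/eqP.
have [Tp|nTp] := pselect (TL p); last first.
  rewrite -(prob_full_setI _ _ L1)// (_ : _ `&` _ = set0) /prob ?measure0//.
  by rewrite -subset0 => t [Tt]/= tp; apply: nTp; rewrite -tp.
have [+ _] := typical_low Tp pb; rewrite (mixture_lt _ ML) (mixture_le _ ML) prob_set1.
have := cdf_lt_le L p; have := cdf_lt_le H p; case/andP: t01; nra.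
Qed.

Lemma next_bid_high p : cdf_le H p < 1 ->
  exists q, [/\ p <= q, cdf_le H q = cdf_le H p & uh + q <= cdf_le M q ^+ N].
Proof.
move=> Hp; have [_ _ H1] := bH.
have p1 : p < 1 by rewrite ltNge; apply/negP => /cdf_le_high Hp1; rewrite Hp1 ltxx in Hp.
(* With a cap above [1], the whole mass of [H] lies strictly below it. *)
have [||t Tt _|q [/andP[pq _] ? ?]] := @next_bid N M H TH p 2 uh mTH H1; last by exists q.
- by lra.
- apply: (lt_le_trans Hp); apply: (@le_trans _ _ (cdf_le H 1)).
    by rewrite cdf_le_high.
  by apply: cdf_le_lt; lra.
- by split; [exact: high_no_atom|have [_ ->] := typical_high Tt].
Qed.

Lemma next_bid_low p : 0 < theta -> p < b -> cdf_le L p < cdf_lt L b ->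
  exists q, [/\ p <= q < b, cdf_le L q = cdf_le L p & ul + q <= cdf_le M q ^+ N].
Proof.
move=> t0 pb Lpb; have [_ _ L1] := bL.
apply: (next_bid mTL L1 pb Lpb) => t Tt /andP[_ tb].
by split; [exact: low_no_atom|have [_ ->] := typical_low Tt tb].
Qed.

(** Here [a] is the infimum of the optimal high bids above [0]. Let [a < b]. If no low type bids up
    to [a], then [a] beats nobody and [uh + a <= 0]. Otherwise low types start at some [q < a] that
    beats nobody, so [ul <= 0]; a low type could also bid just above [a], whence [uh <= ul]. *)
Lemma lowest_high_bid : exists a,
  [/\ 0 <= a, cdf_le H a = 0, uh + a <= cdf_le M a ^+ N & a < b -> uh <= 0].
Proof.
have [H1 _ _] := bH; have [L1 _ _] := bL.
have [b0 b1] := andP b01; have [t0 t1] := andP t01.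
have H0 : cdf_le H 0 = 0 by rewrite -high_no_atom (cdf_lt_out H1).
have [|a [a0 Ha ua]] := @next_bid_high 0; first by rewrite H0.
rewrite H0 in Ha.
exists a; split=> // ab.
have Fa : cdf_le M a = theta * cdf_le L a by rewrite (mixture_le _ ML) Ha mulr0 addr0.
have zero q : theta * cdf_le L q = 0 -> cdf_le H q = 0 -> cdf_le M q ^+ N = 0.
  by move=> Lq Hq; rewrite (mixture_le _ ML) Lq Hq mulr0 addr0 expr0n gtn_eqF.
have [La|La] := eqVneq (theta * cdf_le L a) 0.
  by move: ua; rewrite zero//; lra.
have {}t0 : 0 < theta.
  by rewrite lt_neqAle t0 andbT eq_sym; apply: contraNneq La => ->; rewrite mul0r.
have {}La : 0 < cdf_le L a.
  by rewrite lt_neqAle cdf_le_ge0 andbT eq_sym; apply: contraNneq La => ->; rewrite mulr0.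
have L0 : cdf_le L 0 = 0 by rewrite -low_no_atom// (cdf_lt_out L1).
have [|q [/andP[q0 qb] Lq uq]] := next_bid_low t0 b0.
  by rewrite L0 (lt_le_trans La)// cdf_le_lt.
rewrite L0 in Lq.
have qa : q < a.
  rewrite ltNge; apply/negP => aq.
  by have := cdf_le_nd L aq; rewrite Lq leNgt La.
have Hq : cdf_le H q = 0.
  by apply/eqP; rewrite eq_le cdf_le_ge0 andbT -Ha; apply: cdf_le_nd; exact: ltW.
have := @deviate_up _ _ _ _ _ a bL; rewrite a0 ab => /(_ isT).
move: uq; rewrite zero ?Lq ?mulr0//; lra.
Qed.

(** A high type can imitate any bid of a low type. *)
Lemma low_le_high : ul <= uh.
Proof.
have [t /andP[t0 tb] <-] := best_nonempty bL; have [_ + _] := bH; apply.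
by rewrite t0 (le_trans tb)//; case/andP: b01 => _ /ltW.
Qed.

(** If the lowest high bid [a] is at least [b], only low types can lie below it, so
    [uh + a <= theta ^+ N <= b <= a]. The case [a < b] is settled by [lowest_high_bid]. *)
Lemma large_budget_payoffs : theta ^+ N <= b -> uh = 0 /\ ul = 0.
Proof.
move=> tb; have [b0 b1] := andP b01; have [t0 t1] := andP t01.
have uh0 : uh <= 0.
  have [a [a0 Ha ua ab]] := lowest_high_bid.
  have [ba|/ab//] := leP b a.
  have : cdf_le M a ^+ N <= theta ^+ N.
    rewrite (mixture_le _ ML) Ha mulr0 addr0.
    by apply: lerXn2r; rewrite ?nnegrE ?mulr_ge0 ?cdf_le_ge0// ler_piMr ?cdf_le_le1.
  lra.
have := best_ge0 (ltW b0) bL; have := low_le_high; lra.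
Qed.

End Profile.
End Equilibrium.

(** * Small budgets *)

Section SmallBudget.
Context {R : realType}.
Implicit Types (x y : R).

Lemma rootXn (N : nat) x : (0 < N)%N -> 0 <= x -> (x ^+ N) `^ (N%:R^-1) = x.
Proof.
move=> N0 x0; rewrite -powR_mulrn// -powRrM mulfV ?powRr1//.
by rewrite pnatr_eq0 -lt0n.
Qed.

Lemma Xnroot (N : nat) y : (0 < N)%N -> 0 <= y -> (y `^ (N%:R^-1)) ^+ N = y.
Proof.
move=> N0 y0; rewrite -powR_mulrn ?powR_ge0// -powRrM mulVf ?powRr1//.
by rewrite pnatr_eq0 -lt0n.
Qed.

Lemma tie_win_0 (N : nat) y : tie_win N 0 y = y ^+ N / N.+1%:R.
Proof.
rewrite /tie_win big_ord_recl/= subn0 mulr1 big1 ?addr0 1?mulrC// => i _.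
by rewrite /bump/= add1n expr0n/= mulr0.
Qed.

Context (N : nat) (theta b : R) (L H M : strategy R) (ul uh : R).
Context (N0 : (0 < N)%N) (b01 : 0 < b < 1) (t01 : 0 <= theta < 1).
Context (ML : mixture theta L H M).
Context (bL : best L b (pay N M) ul) (bH : best H 1 (pay N M) uh).
Context (tb : b < theta ^+ N).

Let t0 : 0 < theta.
Proof.
have [b0 b1] := andP b01; have [t0 t1] := andP t01.
rewrite lt_neqAle t0 andbT; apply/eqP => t00.
by move: tb; rewrite -t00 expr0n gtn_eqF//= ltNge ltW.
Qed.

(** Bidding just above [b] beats all low types, so [uh >= theta ^+ N - b > 0], which excludes
    [a < b]. For [a >= b] the bid [a] faces exactly [F a = theta]; then [uh + a <= theta ^+ N]
    leaves only [a = b]. *)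
Lemma high_payoff_small : uh = theta ^+ N - b /\ cdf_le H b = 0.
Proof.
have [b0 b1] := andP b01; have [_ t1] := andP t01.
have [a [a0 Ha ua ab]] := lowest_high_bid N0 b01 t01 ML bL bH.
have dev : theta ^+ N <= uh + b.
  have := @deviate_up _ _ _ _ _ _ b bH; rewrite (ltW b0) b1 => /(_ isT).
  apply: le_trans; apply: lerXn2r; rewrite ?nnegrE ?cdf_le_ge0 ?(ltW t0)//.
  rewrite (mixture_le _ ML) (cdf_le_low bL (lexx b)) mulr1 lerDl.
  by rewrite mulr_ge0 ?cdf_le_ge0// subr_ge0 ltW.
have ba : b <= a by rewrite leNgt; apply/negP => /ab; move: tb; lra.
have Fa : cdf_le M a = theta by rewrite (mixture_le _ ML) (cdf_le_low bL ba) Ha mulr1 mulr0 addr0.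
rewrite Fa in ua; have ab' : a = b by lra.
by rewrite -{2}ab' Ha; split => //; lra.
Qed.

Let cdf_high p : b <= p <= 1 - theta ^+ N + b ->
  (theta + (1 - theta) * cdf_le H p) ^+ N = p + theta ^+ N - b.
Proof.
move=> /andP[bp pc]; have [b0 b1] := andP b01; have [_ t1] := andP t01.
have [uhE Hb] := high_payoff_small.
have FE q : b <= q -> cdf_le M q = theta + (1 - theta) * cdf_le H q.
  by move=> bq; rewrite (mixture_le _ ML) (cdf_le_low bL bq) mulr1.
rewrite -FE//; apply/eqP; rewrite eq_le; apply/andP; split.
  have := @deviate_up _ _ _ _ _ _ p bH; rewrite uhE (le_trans (ltW b0) bp).
  move=> /(_ _); have -> : p < 1 by move: tb; lra.
  by move=> /(_ isT); lra.
rewrite leNgt; apply/negP => lt.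
have Hp : cdf_le H p < 1.
  rewrite lt_neqAle cdf_le_le1 andbT; apply/eqP => Hp.
  by move: lt; rewrite FE// Hp mulr1 addrC subrK expr1n; lra.
(* The next high bid [q] would pay at least [p] against the same value of [F], too little to earn
   [uh]. *)
have [q [pq Hq]] := next_bid_high N0 t01 ML bH Hp.
rewrite (FE q (le_trans bp pq)) Hq -FE// uhE; lra.
Qed.

Lemma high_strategy_small :
  randomizes_in H b (1 - theta ^+ N + b) (Gh_small N.+1 theta b).
Proof.
have [b0 b1] := andP b01; have [_ t1] := andP t01.
have [_ Hb] := high_payoff_small.
have root p : b <= p <= 1 - theta ^+ N + b ->
    theta + (1 - theta) * cdf_le H p = (p + theta ^+ N - b) `^ (N%:R^-1).
  move=> /cdf_high <-; rewrite rootXn// addr_ge0 ?(ltW t0)//.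
  by rewrite mulr_ge0 ?cdf_le_ge0// subr_ge0 ltW.
have tN1 : theta ^+ N <= 1 by rewrite exprn_ile1 ?(ltW t0)// ltW.
have bc : b <= 1 - theta ^+ N + b by lra.
split.
  rewrite probE; last exact: measurable_itv.
  congr EFin; rewrite prob_itvcc//.
  have -> : cdf_lt H b = 0.
    by apply/eqP; rewrite eq_le cdf_lt_ge0 andbT -Hb cdf_lt_le.
  have := root _ (introT andP (conj bc (lexx _))).
  rewrite (_ : _ - b = 1); last by ring.
  rewrite powR1 subr0 => h; apply: (@mulfI _ (1 - theta)); first by rewrite subr_eq0 gt_eqF.
  by rewrite mulr1; lra.
move=> p pc; rewrite probE; last exact: measurable_itv.
congr EFin; rewrite -[prob _ _]/(cdf_le H p) /Gh_small/= -root//.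
by rewrite addrAC subrr add0r mulrC mulKf// subr_eq0 gt_eqF.
Qed.

Lemma low_strategy_small : exists mu,
  [/\ 0 < mu <= 1, L [set b] = mu%:E, randomizes_in L 0 b (Gl_atom N.+1 theta b mu),
      ul = tie_win N (theta * (1 - mu)) theta - b & mu < 1 -> ul = 0].
Proof.
have [b0 b1] := andP b01; have [_ t1] := andP t01.
have [uhE Hb] := high_payoff_small.
have ul0 := best_ge0 (ltW b0) bL.
have L1 : prob L `[0, b]%classic = 1 by case: bL.
have Lb := cdf_le_low bL (lexx b).
have Hp0 p : p <= b -> cdf_le H p = 0.
  by move=> pb; apply/eqP; rewrite eq_le cdf_le_ge0 andbT -Hb cdf_le_nd.
have FE p : p <= b -> cdf_le M p = theta * cdf_le L p.
  by move=> pb; rewrite (mixture_le _ ML) Hp0// mulr0 addr0.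
have Fb : cdf_le M b = theta by rewrite FE// Lb mulr1.
have Fltb : cdf_lt M b = theta * cdf_lt L b.
  have -> : cdf_lt M b = theta * cdf_lt L b + (1 - theta) * cdf_lt H b by exact: mixture_lt.
  by rewrite (high_no_atom N0 t01 ML bH) Hb mulr0 addr0.
pose mu := 1 - cdf_lt L b.
have muE : cdf_lt L b = 1 - mu by rewrite /mu; lra.
have mu01 : 0 <= mu <= 1.
  by have := cdf_lt_ge0 L b; have := cdf_lt_le L b; rewrite Lb /mu; lra.
have Lmu : prob L [set b] = mu by rewrite prob_set1 Lb.
have payb : pay N M b = tie_win N (theta * (1 - mu)) theta - b.
  by rewrite /pay Fltb Fb muE.
have L0 : cdf_le L 0 = 0 by rewrite -(low_no_atom N0 t01 ML bL)// (cdf_lt_out L1).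
(* If some low types bid below [b], the lowest such bid [q] has [F q = 0], so [ul + q <= 0]. *)
have mu1_ul : mu < 1 -> ul = 0.
  move=> mu1.
  have [|q [/andP[q0 qb] Lq]] := next_bid_low N0 t01 ML bL (p := 0) t0 b0.
    by rewrite L0 muE subr_gt0.
  by rewrite FE ?(ltW qb)// Lq L0 mulr0 expr0n gtn_eqF//=; lra.
(* Without an atom, the bid [b] would earn [theta ^+ N - b > 0], while [ul = 0]. *)
have mu0 : 0 < mu.
  rewrite lt_neqAle; case/andP: mu01 => -> _; rewrite andbT; apply/eqP => mu0.
  have := mu1_ul; rewrite -mu0 ltr01 => /(_ isT) ulE.
  have [_ /(_ b) + _] := bL; rewrite lexx (ltW b0) => /(_ isT).
  by rewrite payb -mu0 subr0 mulr1 tie_win_id ulE; move: tb; lra.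
have ulE : ul = tie_win N (theta * (1 - mu)) theta - b.
  rewrite -payb; have [_ _ u1] := bL.
  apply: contrapT => neq; move: mu0; rewrite -Lmu -(prob_full_setI _ _ u1).
  - rewrite (_ : _ `&` _ = set0) /prob ?measure0 ?ltxx// -subset0 => t [[_ /= tu] tbE].
    by apply: neq; rewrite -tu tbE.
  - apply: measurableI; first exact: measurable_itv.
    by apply: measurable_level; exact: measurable_pay.
  - exact: measurable_set1.
have [_ mu1] := andP mu01.
have X0 : 0 <= theta * (1 - mu) by rewrite mulr_ge0 ?(ltW t0)// subr_ge0.
have XE : (1 - mu) ^+ N * theta ^+ N = (theta * (1 - mu)) ^+ N by rewrite exprMn mulrC.
exists mu; split=> //; first by rewrite mu0.
  by rewrite probE ?Lmu//; exact: measurable_set1.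
split; first by rewrite probE ?L1//; exact: measurable_itv.
move=> p /andP[p0 pb]; rewrite probE; last exact: measurable_itv.
congr EFin; rewrite -[prob _ _]/(cdf_le L p) /Gl_atom/= XE.
(* At [p = b] the first branch of [Gl_atom] has to be excluded: for [mu < 1], indifference gives
   [(theta * (1 - mu)) ^+ N <= b], because [tie_win] is monotone in its second argument. *)
move: pb; rewrite le_eqVlt => /predU1P[->|pb].
  rewrite Lb ltxx; case: ltP => // bX.
  have mu1' : mu < 1.
    rewrite lt_neqAle mu1 andbT; apply/eqP => mu1'; move: bX.
    by rewrite mu1' subrr mulr0 expr0n gtn_eqF//= ltNge ltW.
  move: bX; rewrite -(tie_win_id N) ltNge.
  have -> // : tie_win N (theta * (1 - mu)) (theta * (1 - mu)) <= b.
  have -> : b = tie_win N (theta * (1 - mu)) theta by have := mu1_ul mu1'; lra.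
  by apply: tie_win_le => //; rewrite ler_piMr ?(ltW t0)//; lra.
(* While low bids below [b] remain above [p], the next one forces equality. Once [1 - mu] is reached
   the cdf stays flat up to [b]: this is the gap in the support. *)
have gap : cdf_le L p < 1 - mu -> (theta * cdf_le L p) ^+ N = p.
  move=> Lp; have ul00 : ul = 0 by apply: mu1_ul; have := cdf_le_ge0 L p; lra.
  have [|q [/andP[pq qb] Lq]] := next_bid_low N0 t01 ML bL t0 pb; first by rewrite muE.
  rewrite FE ?(ltW qb)// Lq ul00 add0r => qF.
  have := @deviate_up _ _ _ _ _ _ p bL; rewrite p0 pb => /(_ isT).
  by rewrite FE ?(ltW pb)// ul00 add0r => Fp; apply/eqP; rewrite eq_le Fp (le_trans pq).
have Lpmu : cdf_le L p <= 1 - mu by rewrite -muE cdf_le_lt.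
have Lp0 := cdf_le_ge0 L p.
rewrite pb; case: ltP => [pX|Xp].
  have Lp : cdf_le L p < 1 - mu.
    rewrite lt_neqAle Lpmu andbT; apply/eqP => Lp.
    have mu1' : mu < 1.
      rewrite lt_neqAle mu1 andbT; apply/eqP => mu1'; move: pX.
      by rewrite mu1' subrr mulr0 expr0n gtn_eqF//= ltNge p0.
    have := @deviate_up _ _ _ _ _ _ p bL; rewrite p0 pb => /(_ isT).
    by rewrite FE ?(ltW pb)// Lp (mu1_ul mu1') add0r leNgt pX.
  have -> : p `^ (N%:R^-1) = theta * cdf_le L p.
    by rewrite -[in LHS](gap Lp) rootXn// mulr_ge0 ?(ltW t0).
  by rewrite mulrC mulKf// gt_eqF.
apply/eqP; rewrite eq_le Lpmu leNgt; apply/negP => Lp.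
move: Xp; rewrite -[X in _ <= X](gap Lp) leNgt => /negP; apply.
by rewrite ltrXn2r ?gtn_eqF// ?mulr_ge0 ?(ltW t0)// ltr_pM2l.
Qed.

End SmallBudget.

(** * Sufficient conditions *)

Section Sufficiency.
Context {R : realType}.
Implicit Types (P L H M : strategy R) (p q x y theta b c u k : R) (N : nat).

Lemma best_level N M P D c u : measurable D -> prob P D = 1 ->
  (forall p, D p -> 0 <= p <= c /\ pay N M p = u) ->
  (forall p, 0 <= p <= c -> pay N M p <= u) -> best P c (pay N M) u.
Proof.
move=> mD D1 Du le.
have ge1 A : measurable A -> D `<=` A -> prob P A = 1.
  by move=> mA DA; apply/eqP; rewrite eq_le prob_le1//= -D1; exact: prob_mono.
split=> //; apply: ge1; first exact: measurable_itv.
- by move=> p /Du[pc _]; rewrite /= in_itv/=.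
- apply: measurableI; first exact: measurable_itv.
  by apply: measurable_level; exact: measurable_pay.
- by move=> p /Du[pc pu]; split => //=; rewrite in_itv/=.
Qed.

(** A left limit: with [pay_squeeze], lower bounds on the cdf before [p] give the exact payoff at
    [p], with no separate discussion of atoms. *)
Lemma cdf_lt_leX N M a k p : a < p ->
  (forall q, a <= q < p -> q + k <= cdf_le M q ^+ N) -> p + k <= cdf_lt M p ^+ N.
Proof.
move=> ap h; rewrite leNgt; apply/negP => lt.
have step q : a <= q < p -> q + k <= cdf_lt M p ^+ N.
  move=> aqp; apply: le_trans (h _ aqp) _.
  apply: lerXn2r; rewrite ?nnegrE ?cdf_le_ge0 ?cdf_lt_ge0//.
  by apply: cdf_le_lt; case/andP: aqp.
have [h2|h2] := leP ((p + (cdf_lt M p ^+ N - k)) / 2) a.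
  have := step a; rewrite lexx ap => /(_ isT); lra.
have := step ((p + (cdf_lt M p ^+ N - k)) / 2); rewrite (ltW h2) /=.
have -> : (p + (cdf_lt M p ^+ N - k)) / 2 < p by lra.
by move=> /(_ isT); lra.
Qed.

Lemma pay_leX N M p : pay N M p <= cdf_le M p ^+ N - p.
Proof. by rewrite /pay lerD2r tie_win_leX. Qed.

Lemma pay_squeeze N M p u : u + p <= cdf_lt M p ^+ N -> cdf_le M p ^+ N <= u + p ->
  pay N M p = u.
Proof.
move=> lo hi; apply/eqP; rewrite eq_le; apply/andP; split.
  by have := pay_leX N M p; lra.
have : cdf_lt M p ^+ N <= tie_win N (cdf_lt M p) (cdf_le M p).
  by rewrite -tie_win_id tie_win_le ?cdf_lt_ge0 ?cdf_lt_le.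
by rewrite /pay; lra.
Qed.

Lemma randomizes_cdf P a c G p : randomizes_in P a c G -> a <= p <= c -> cdf_le P p = G p.
Proof. by move=> [_ h] /h; rewrite /cdf_le /prob => ->. Qed.

(** The two cdfs are glued so that [cdf_le M p ^+ N = p] on [[0, 1]]. Every feasible bid then earns
    zero, so every feasible strategy is a best response. *)
Lemma large_budget_sufficient N theta b L H : (0 < N)%N -> 0 < b < 1 -> 0 <= theta < 1 ->
  theta ^+ N <= b -> L `[0, b]%classic = 1%E -> large_budget_profile N.+1 theta L H ->
  symmetric_equilibrium N.+1 theta b L H.
Proof.
move=> N0 /andP[b0 b1] /andP[t0 t1] tb Lb [profL profH].
have [M ML _] := mixture_exists L H (introT andP (conj t0 (ltW t1))).
have tN0 : 0 <= theta ^+ N by rewrite exprn_ge0.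
have t1' : 1 - theta != 0 by rewrite subr_eq0 gt_eqF.
have FX p : 0 <= p <= 1 -> cdf_le M p ^+ N = p.
  move=> /andP[p0 p1]; rewrite (_ : cdf_le M p = p `^ (N%:R^-1)) ?Xnroot//.
  rewrite (mixture_le _ ML).
  have high : theta ^+ N <= p -> (1 - theta) * cdf_le H p = p `^ (N%:R^-1) - theta.
    move=> tp; rewrite (randomizes_cdf profH) ?tp//.
    by rewrite /Gh_large/= mulrC divfK.
  (* For [theta = 0] the profile says nothing about [L], but [L] has weight zero in the mixture. *)
  have [t00|t00] := eqVneq theta 0.
    by rewrite high t00 ?expr0n ?gtn_eqF// mul0r subr0 add0r.
  have tp : 0 < theta by rewrite lt_neqAle eq_sym t00.
  have := profL tp; rewrite /= => rL.
  have [tNp|ptN] := leP (theta ^+ N) p.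
    rewrite high//; have [_ ->//] := cdf_le_out p rL.1; rewrite mulr1; ring.
  have [-> // _] := cdf_le_out p profH.1.
  rewrite (randomizes_cdf rL) ?p0 ?ltW// /Gl_large/= mulr0 addr0.
  by rewrite mulrC divfK.
have pay0 p : 0 <= p <= 1 -> pay N M p = 0.
  move=> /andP[p0 p1]; apply: pay_squeeze; rewrite add0r; last by rewrite FX ?p0.
  move: p0; rewrite le_eqVlt => /predU1P[<-|p0]; first by rewrite exprn_ge0 ?cdf_lt_ge0.
  rewrite -[leLHS]addr0; apply: (cdf_lt_leX p0) => q /andP[q0 qp].
  by rewrite addr0 FX// q0 (le_trans (ltW qp)).
have H1 : prob H `[0, 1]%classic = 1.
  apply/eqP; rewrite eq_le prob_le1 /=; last exact: measurable_itv.
  apply: (@le_trans _ _ (prob H `[theta ^+ N, 1]%classic)).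
    by rewrite /prob profH.1.
  apply: prob_mono; [exact: measurable_itv|exact: measurable_itv|].
  move=> x /=; rewrite !in_itv/= => /andP[tx x1].
  by apply/andP; split => //; exact: le_trans tx.
apply: (best_equilibrium ML (ul := 0) (uh := 0)).
- apply: (@best_level _ _ _ `[0, b]%classic); first exact: measurable_itv.
  + by rewrite /prob Lb.
  + move=> p /=; rewrite in_itv/= => /andP[p0 pb]; rewrite p0 pb; split => //.
    by rewrite pay0// p0 (le_trans pb (ltW b1)).
  + by move=> p /andP[p0 pb]; rewrite pay0// p0 (le_trans pb (ltW b1)).
- apply: (@best_level _ _ _ `[0, 1]%classic) => //.
  + by move=> p /=; rewrite in_itv/= => p01; split => //; exact: pay0.
  + by move=> p p01; rewrite pay0.
Qed.

(** The last two hypotheses say that [b] is no worse for a low type than earning zero, and exactly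
    as good if low types also bid less. *)
Lemma small_budget_sufficient N theta b L H mu : (0 < N)%N -> 0 < b < 1 ->
  0 <= theta < 1 -> b < theta ^+ N -> 0 < mu <= 1 ->
  randomizes_in H b (1 - theta ^+ N + b) (Gh_small N.+1 theta b) ->
  randomizes_in L 0 b (Gl_atom N.+1 theta b mu) ->
  b <= tie_win N (theta * (1 - mu)) theta ->
  (mu < 1 -> tie_win N (theta * (1 - mu)) theta = b) ->
  symmetric_equilibrium N.+1 theta b L H.
Proof.
move=> N0 /andP[b0 b1] /andP[t0' t1] tb /andP[mu0 mu1] rH rL wge weq.
have [M ML _] := mixture_exists L H (introT andP (conj t0' (ltW t1))).
have t0 : 0 < theta.
  rewrite lt_neqAle t0' andbT; apply/eqP => t00.
  by move: tb; rewrite -t00 expr0n gtn_eqF//= ltNge ltW.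
have t1' : 1 - theta != 0 by rewrite subr_eq0 gt_eqF.
have tN1 : theta ^+ N <= 1 by rewrite exprn_ile1 ?(ltW t0)// ltW.
set c := 1 - theta ^+ N + b in rH.
have bc : b <= c by rewrite /c; lra.
have c1 : c < 1 by rewrite /c; lra.
(* [X] is the value of [F] just below [b], and [s] is the top of the continuous part of the low
   strategy; no type bids in the gap between [s] and [b]. *)
pose X := theta * (1 - mu); pose s := X ^+ N.
have X0 : 0 <= X by rewrite mulr_ge0// subr_ge0.
have s0 : 0 <= s by rewrite exprn_ge0.
have Xt : X < theta by rewrite /X gtr_pMr//; lra.
have sb : s < b.
  move: mu1; rewrite le_eqVlt => /predU1P[mu1|mu1].
    by rewrite /s /X mu1 subrr mulr0 expr0n gtn_eqF.
  by rewrite -(weq mu1) /s -tie_win_id tie_win_ltr.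
have XE : (1 - mu) ^+ N * theta ^+ N = s by rewrite /s exprMn mulrC.
have Llow p : p < 0 -> cdf_le L p = 0 by move=> p0; have [->] := cdf_le_out p rL.1.
have Ltop p : b <= p -> cdf_le L p = 1 by move=> bp; have [_ ->] := cdf_le_out p rL.1.
have LX p : 0 <= p < b -> (theta * cdf_le L p) ^+ N = Num.min p s.
  move=> /andP[p0 pb]; rewrite (randomizes_cdf rL) ?p0 ?ltW//.
  rewrite /Gl_atom/= pb XE; case: ltP => ps.
    by rewrite mulrC divfK ?gt_eqF// Xnroot// min_l// ltW.
  by rewrite -/X ?min_r.
have Lle p : p < b -> cdf_le L p <= 1 - mu.
  move=> pb; have [p0|p0] := ltP p 0; first by rewrite Llow// subr_ge0.
  have := LX p; rewrite p0 pb => /(_ isT) E.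
  rewrite -(ler_pM2l t0) -/X -(@ler_pXn2r _ N)// ?nnegrE ?mulr_ge0 ?cdf_le_ge0 ?(ltW t0)//.
  by rewrite E ge_min lexx orbT.
have Ls : cdf_le L s = 1 - mu.
  rewrite (randomizes_cdf rL) ?s0 ?ltW//.
  by rewrite /Gl_atom/= XE ltxx sb.
have Llt : cdf_lt L b = 1 - mu.
  apply/eqP; rewrite eq_le (cdf_lt_lc Lle) /= -Ls; exact: cdf_le_lt.
have Hlow p : p < b -> cdf_le H p = 0 by move=> p0; have [->] := cdf_le_out p rH.1.
have Fhigh p : b <= p <= c -> cdf_le M p ^+ N = p + theta ^+ N - b.
  move=> /andP[bp pc]; rewrite (mixture_le _ ML) Ltop// mulr1.
  rewrite (randomizes_cdf rH) ?bp// /Gh_small/= [X in theta + X]mulrC divfK//.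
  by rewrite addrC subrK Xnroot//; lra.
have Hb : cdf_le H b = 0.
  rewrite (randomizes_cdf rH) ?lexx// /Gh_small/= addrAC subrr add0r.
  by rewrite rootXn ?ltW// subrr mul0r.
have Hb' : cdf_lt H b = 0 by apply/eqP; rewrite eq_le cdf_lt_ge0 andbT -Hb cdf_lt_le.
have Flow p : p < b -> cdf_le M p = theta * cdf_le L p.
  by move=> pb; rewrite (mixture_le _ ML) Hlow// mulr0 addr0.
have payb : pay N M b = tie_win N X theta - b.
  by rewrite /pay (mixture_le _ ML) (mixture_lt _ ML) Hb Hb' Ltop// Llt !mulr0 !addr0 mulr1.
have paylow p : 0 <= p < b -> pay N M p <= 0.
  move=> /andP[p0 pb]; apply: le_trans (pay_leX _ _ _) _.
  by rewrite Flow// LX ?p0// subr_le0 ge_min lexx.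
have pays p : 0 <= p <= s -> pay N M p = 0.
  move=> /andP[p0 ps]; apply: pay_squeeze; rewrite add0r; last first.
    by rewrite Flow ?(le_lt_trans ps)// LX ?p0 ?(le_lt_trans ps)// ge_min lexx.
  move: p0; rewrite le_eqVlt => /predU1P[<-|p0]; first by rewrite exprn_ge0 ?cdf_lt_ge0.
  rewrite -[leLHS]addr0; apply: (cdf_lt_leX p0) => q /andP[q0 qp].
  have qs : q < s := lt_le_trans qp ps.
  by rewrite addr0 Flow ?(lt_trans qs)// LX ?q0 ?(lt_trans qs)// le_min lexx ltW.
have Lb1 : prob L [set b] = mu by rewrite prob_set1 Ltop// Llt; lra.
apply: (best_equilibrium ML (ul := tie_win N X theta - b) (uh := theta ^+ N - b)).
- have below p : 0 <= p <= b -> pay N M p <= tie_win N X theta - b.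
    move=> /andP[p0]; rewrite le_eqVlt => /predU1P[->|pb]; first by rewrite payb.
    apply: le_trans (paylow p _) _; first by rewrite p0.
    by rewrite subr_ge0.
  (* If all low types bid [b] their payoff may be positive, and then the bids in [[0, s]] would not
     be optimal. *)
  have [mu1'|mu1'] := eqVneq mu 1.
    apply: (@best_level _ _ _ [set b]) => //; first by rewrite Lb1.
    by move=> p ->; rewrite payb lexx ltW.
  have {}mu1' : mu < 1 by rewrite lt_neqAle mu1'.
  have u0 : tie_win N X theta - b = 0 by rewrite weq// subrr.
  apply: (@best_level _ _ _ (`[0, s]%classic `|` [set b])) => //.
  + by apply: measurableU; [exact: measurable_itv|exact: measurable_set1].
  + rewrite probU; [|exact: measurable_itv|exact: measurable_set1|].
      rewrite prob_itvcc// Ls Lb1 (cdf_lt_out (c := b)) ?subr0 ?subrK//.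
      by rewrite /prob rL.1.
    rewrite -subset0 => p [/=]; rewrite in_itv/= => /andP[_ ps] pb.
    by move: ps; rewrite pb leNgt sb.
  + move=> p [|->]; last by rewrite payb lexx ltW.
    rewrite /= in_itv/= => /andP[p0 ps]; rewrite u0 pays ?p0//.
    by rewrite (le_trans ps) ?ltW.
(* At [b] a high type ties with the low atom and earns strictly less, so this null bid is
   removed. *)
- apply: (@best_level _ _ _ (`[b, c]%classic `\` [set b])).
  + by apply: measurableD; [exact: measurable_itv|exact: measurable_set1].
  + rewrite probD ?prob_set1 ?Hb ?Hb' ?subrr ?subr0.
    * by rewrite /prob rH.1.
    * exact: measurable_set1.
    * exact: measurable_itv.
    * by move=> p ->; rewrite /= in_itv/= lexx.
  + move=> p [/=]; rewrite in_itv/= => /andP[bp pc] /eqP pb.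
    split; first by rewrite (le_trans (ltW b0) bp) (le_trans pc) ?ltW.
    have {pb}pb : b < p by rewrite lt_neqAle eq_sym pb.
    apply: pay_squeeze; last by rewrite Fhigh ?bp//; lra.
    rewrite addrC; apply: (cdf_lt_leX pb) => q /andP[bq qp].
    by rewrite Fhigh ?bq ?(le_trans (ltW qp))//; lra.
  + move=> p /andP[p0 p1]; have [pb|bp] := ltP p b.
      by apply: le_trans (paylow p _) _; rewrite ?p0//; lra.
    have [pc|cp] := leP p c.
      by apply: le_trans (pay_leX _ _ _) _; rewrite Fhigh ?bp//; lra.
    apply: le_trans (pay_leX _ _ _) _.
    have : cdf_le M p ^+ N <= 1 by rewrite exprn_ile1 ?cdf_le_ge0 ?cdf_le_le1.
    by move: cp; rewrite /c; lra.
Qed.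

End Sufficiency.

(** * Existence *)

Section Existence.
Context {R : realType}.
Implicit Types (P L H M : strategy R) (p q u v theta b c k mu : R) (N : nat).

(* [P] is the law of [g U] for [U] uniform on [[0, 1]]. *)
Lemma quantile_strategy (g : R -> R) : {homo g : x y / x <= y} ->
  exists P, forall (A : set (measurableTypeR R)) v, measurable A -> 0 <= v <= 1 ->
    (forall u, 0 <= u <= 1 -> A (g u) <-> u <= v) -> P A = v%:E.
Proof.
move=> gnd.
have mg : measurable_fun setT (g : measurableTypeR R -> measurableTypeR R).
  exact: nondecreasing_measurable.
pose U : strategy R := uniform_prob (@ltr01 R).
have [P PE] : exists P : strategy R, forall A, P A = U (g @^-1` A).
  pose g' : measurableTypeR R -> measurableTypeR R := g.
  pose X : {mfun measurableTypeR R >-> measurableTypeR R} :=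
    HB.pack_for {mfun measurableTypeR R >-> measurableTypeR R} g'
      (@isMeasurableFun.Build _ _ _ _ g' mg).
  by exists (distribution U X).
exists P => A v mA /andP[v0 v1] Av.
rewrite PE /U /= /uniform_prob integral_uniform_pdf.
rewrite (_ : _ `&` _ = `[0, v]%classic); last first.
  apply/seteqP; split => u /=; rewrite !in_itv/=.
    by move=> [Au u01]; case/andP: (u01) => -> _; apply/Av.
  move=> /andP[u0 uv]; have u1 := le_trans uv v1.
  by split; [apply/Av|]; rewrite ?u0.
rewrite (eq_integral (cst 1%E)); last first.
  move=> u; rewrite inE/= in_itv/= => /andP[u0 uv]; rewrite /uniform_pdf.
  by rewrite u0 (le_trans uv v1) subr0 invr1.
rewrite integral_cst//= mul1e lebesgue_measure_itv/= lte_fin.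
case: ltP => [_|v0']; first by rewrite oppr0 adde0.
by congr EFin; apply/eqP; rewrite eq_le v0.
Qed.

(** The shift [k] serves both regimes: [k = b - theta ^+ N] for small budgets and [k = 0] for large
    ones. On [[0, 1]] the map [g] inverts the cdf; [Num.max 0 u] only keeps it monotone on the whole
    line. *)
Lemma high_strategy_exists N theta k : (0 < N)%N -> 0 <= theta < 1 ->
  exists H, randomizes_in H (theta ^+ N + k) (1 + k)
    (fun p => ((p - k) `^ (N%:R^-1) - theta) / (1 - theta)).
Proof.
move=> N0 /andP[t0 t1]; have t1' : 0 < 1 - theta by rewrite subr_gt0.
pose g u := (theta + (1 - theta) * Num.max 0 u) ^+ N + k.
have base0 u : 0 <= theta + (1 - theta) * Num.max 0 u.
  by rewrite addr_ge0// mulr_ge0 ?(ltW t1')// le_max lexx.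
have gnd : {homo g : x y / x <= y}.
  move=> x y xy; rewrite /g lerD2r; apply: lerXn2r; rewrite ?nnegrE//.
  by rewrite lerD2l ler_pM2l// ge_max !le_max lexx xy orbT.
have gE u : 0 <= u -> g u = (theta + (1 - theta) * u) ^+ N + k.
  by move=> u0; rewrite /g; case: leP u0.
have [H HE] := quantile_strategy gnd.
exists H; split.
  apply: HE => [||u /andP[u0 u1]]; [exact: measurable_itv|by rewrite ler01 lexx|].
  rewrite /= in_itv/= gE// !lerD2r; split=> // _; apply/andP; split.
    by apply: lerXn2r; rewrite ?nnegrE//; nra.
  by rewrite exprn_ile1//; nra.
move=> p /andP[tp p1].
set r := (p - k) `^ _; have r0 : 0 <= r by exact: powR_ge0.
have rN : r ^+ N = p - k by rewrite Xnroot// subr_ge0 (le_trans _ tp)// lerDr exprn_ge0.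
have tr : theta <= r by rewrite -(@ler_pXn2r _ N)// ?nnegrE// rN lerBrDr.
have r1 : r <= 1 by rewrite -(@ler_pXn2r _ N)// ?nnegrE// rN expr1n lerBlDr.
apply: HE => [||u /andP[u0 u1]]; first exact: measurable_itv.
  by rewrite divr_ge0 ?subr_ge0 ?(ltW t1)//= ler_pdivrMr// mul1r lerD2r.
rewrite /= in_itv/= gE// -lerBrDr -rN ler_pXn2r// ?nnegrE//; last by nra.
by rewrite ler_pdivlMr// lerBrDl [u * _]mulrC.
Qed.

(** [g] follows the inverse of the continuous part up to [1 - mu] and then jumps to [b]; the last
    hypothesis keeps the jump upward. The value [mu = 0] with [b = theta ^+ N] gives the low
    strategy for large budgets. *)
Lemma low_strategy_exists N theta b mu : (0 < N)%N -> 0 <= theta -> 0 <= b ->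
  0 <= mu <= 1 -> (theta * (1 - mu)) ^+ N <= b ->
  exists L, randomizes_in L 0 b (Gl_atom N.+1 theta b mu).
Proof.
move=> N0 t0 b0 /andP[mu0 mu1] sb.
set X := theta * (1 - mu) in sb.
have X0 : 0 <= X by rewrite mulr_ge0// subr_ge0.
pose g u := if u <= 1 - mu then (theta * Num.max 0 u) ^+ N else b.
have base0 u : 0 <= theta * Num.max 0 u by rewrite mulr_ge0// le_max lexx.
have gX u : u <= 1 - mu -> (theta * Num.max 0 u) ^+ N <= X ^+ N.
  move=> u1; apply: lerXn2r; rewrite ?nnegrE//.
  by apply: ler_wpM2l => //; rewrite ge_max u1 subr_ge0 mu1.
have gnd : {homo g : x y / x <= y}.
  move=> x y xy; rewrite /g; case: (leP y) => y1.
    rewrite (le_trans xy y1); apply: lerXn2r; rewrite ?nnegrE//.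
    by apply: ler_wpM2l => //; rewrite ge_max !le_max lexx xy orbT.
  by case: (leP x (1 - mu)) => // xm; exact: le_trans (gX _ xm) sb.
have gE u : 0 <= u -> u <= 1 - mu -> g u = (theta * u) ^+ N.
  by move=> u0 u1; rewrite /g u1; case: leP u0.
have gb u : g u <= b by rewrite /g; case: (leP u (1 - mu)) => // um; exact: le_trans (gX _ um) sb.
have [L LE] := quantile_strategy gnd.
exists L; split.
  apply: LE => [||u /andP[u0 u1]]; [exact: measurable_itv|by rewrite ler01 lexx|].
  rewrite /= in_itv/= gb andbT; split=> // _; rewrite /g; case: ifP => // _.
  by rewrite exprn_ge0.
move=> p /andP[p0 pb]; rewrite /Gl_atom/= -exprMn [(1 - mu) * _]mulrC -/X.
case: ltP => [pX|Xp].
  set r := p `^ _; have r0 : 0 <= r by exact: powR_ge0.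
  have rN : r ^+ N = p by rewrite Xnroot.
  have rX : r < X by rewrite -(@ltr_pXn2r _ N)// ?nnegrE// rN.
  have tp : 0 < theta.
    rewrite lt_neqAle t0 andbT; apply/eqP => t00.
    by move: (le_lt_trans r0 rX); rewrite /X -t00 mul0r ltxx.
  have rmu : r / theta < 1 - mu by rewrite ltr_pdivrMr// mulrC.
  apply: LE => [||u /andP[u0 u1]]; first exact: measurable_itv.
    by rewrite divr_ge0//= (le_trans (ltW rmu))// gerBl.
  rewrite /= in_itv/=; have [umu|umu] := leP u (1 - mu).
    rewrite gE// -rN ler_pXn2r// ?nnegrE ?mulr_ge0//.
    by rewrite ler_pdivlMr// [u * _]mulrC.
  rewrite /g (leNgt u (1 - mu)) umu /=; split=> [bp|ur].
    by move: (lt_le_trans pX (le_trans sb bp)); rewrite ltxx.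
  by move: (le_lt_trans ur (lt_trans rmu umu)); rewrite ltxx.
case: ltP => [pb'|bp].
  apply: LE => [||u /andP[u0 u1]]; first exact: measurable_itv.
    by rewrite subr_ge0 mu1 gerBl.
  rewrite /= in_itv/=; have [umu|umu] := leP u (1 - mu).
    by split=> // _; rewrite /g umu (le_trans (gX _ umu)).
  by rewrite /g (leNgt u (1 - mu)) umu /= leNgt pb'.
apply: LE => [||u /andP[u0 u1]]; [exact: measurable_itv|by rewrite ler01 lexx|].
by rewrite /= in_itv/=; split=> // _; rewrite (le_trans (gb u)).
Qed.

(** Intermediate value theorem for the polynomial [tie_win N x theta - b] on [[0, theta]], with
    [x = theta * (1 - mu)]. The strict bound [b < theta ^+ N] excludes [x = theta], that is
    [mu = 0]. *)
Lemma atom_size_exists N theta b : (0 < N)%N -> 0 < theta -> b < theta ^+ N ->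
  theta ^+ N / N.+1%:R <= b ->
  exists2 mu, 0 < mu <= 1 & tie_win N (theta * (1 - mu)) theta = b.
Proof.
move=> N0 t0 tb nb.
pose P : {poly R} := N.+1%:R^-1 *: (\sum_(i < N.+1) theta ^+ (N - i) *: 'X^i) - b%:P.
have PE x : P.[x] = tie_win N x theta - b.
  rewrite /P hornerD hornerN hornerC hornerZ horner_sum; congr (_ * _ - _).
  by apply: eq_bigr => i _; rewrite hornerZ hornerXn.
have [||x /andP[x0 xt]] := @poly_ivt _ P 0 theta; first exact: ltW.
  by rewrite !PE tie_win_0 tie_win_id subr_le0 nb subr_ge0 ltW.
rewrite rootE PE subr_eq0 => /eqP xb.
have {}xt : x < theta.
  rewrite lt_neqAle xt andbT; apply/eqP => xt'.
  by move: tb; rewrite -xb xt' tie_win_id ltxx.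
exists (1 - x / theta); last first.
  by rewrite opprB addrC subrK mulrC divfK// gt_eqF.
by rewrite subr_gt0 ltr_pdivrMr// mul1r xt gerBl divr_ge0// ltW.
Qed.

End Existence.

(** * The equilibrium theorem *)

Theorem proposition2 (R : realType) (n : nat) (b theta : R)
    (hn : (2 <= n)%N) (hb : 0 < b < 1) (htheta : 0 <= theta < 1) :
  (b < theta ^+ n.-1 ->
   exists L H : strategy R,
     [/\ symmetric_equilibrium n theta b L H,
         (forall L' H' : strategy R, symmetric_equilibrium n theta b L' H' ->
            same_strategy L' L /\ same_strategy H' H),
         randomizes_in H b (1 - theta ^+ n.-1 + b) (Gh_small n theta b),
         (b < theta ^+ n.-1 / n%:R -> L [set b] = 1%E) /\
         (theta ^+ n.-1 / n%:R <= b ->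
          exists mu : R,
            [/\ 0 < mu <= 1,
                L [set b] = mu%:E,
                randomizes_in L 0 b (Gl_atom n theta b mu)
              & forall (b' mu' : R) (L' H' : strategy R),
                  b < b' -> b' < theta ^+ n.-1 ->
                  symmetric_equilibrium n theta b' L' H' ->
                  L' [set b'] = mu'%:E -> mu' < mu])
       & [/\ u_high n theta L H = (theta ^+ n.-1 - b)%:E,
             (theta ^+ n.-1 / n%:R <= b -> u_low n theta L H = 0%E)
           & (b < theta ^+ n.-1 / n%:R ->
              u_low n theta L H = (theta ^+ n.-1 / n%:R - b)%:E)]])
  /\
  (theta ^+ n.-1 <= b ->
   [/\ (forall L H : strategy R, symmetric_equilibrium n theta b L H ->
          [/\ revenue n theta L H = 1%E,
              u_high n theta L H = 0%E
            & u_low n theta L H = 0%E]),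
       (exists L H : strategy R,
          large_budget_profile n theta L H /\
          symmetric_equilibrium n theta b L H)
     & (forall L H : strategy R,
          L `[0, b]%classic = 1%E -> large_budget_profile n theta L H ->
          symmetric_equilibrium n theta b L H)]).
Proof.
case: n hn => [|[|N]]// _; set m := N.+1.
have m0 : (0 < m)%N by [].
rewrite -[m.+1.-1]/m.
have [b0 b1] := andP hb; have [t0 t1] := andP htheta.
have ht : 0 <= theta <= 1 by rewrite t0 ltW.
(* Stated for every budget [c], since the monotonicity of the atom compares equilibria at two
   budgets. *)
have small c (L H : strategy R) : 0 < c -> c < theta ^+ m ->
    symmetric_equilibrium m.+1 theta c L H ->
    [/\ randomizes_in H c (1 - theta ^+ m + c) (Gh_small m.+1 theta c),
        u_high m.+1 theta L H = (theta ^+ m - c)%:E &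
        exists mu, [/\ 0 < mu <= 1, L [set c] = mu%:E,
          randomizes_in L 0 c (Gl_atom m.+1 theta c mu) &
          (theta ^+ m / m.+1%:R <= c ->
            u_low m.+1 theta L H = 0%E /\ tie_win m (theta * (1 - mu)) theta = c) /\
          (c < theta ^+ m / m.+1%:R ->
            mu = 1 /\ u_low m.+1 theta L H = (theta ^+ m / m.+1%:R - c)%:E)]].
  move=> c0 ct eq.
  have hc : 0 < c < 1.
    by rewrite c0 (lt_le_trans ct)// exprn_ile1// ltW.
  have [M ML _] := mixture_exists L H ht.
  have [ul [uh [-> -> bL bH]]] := equilibrium_best ML eq.
  have [uhE _] := high_payoff_small m0 hc htheta ML bL bH ct.
  have [mu [mu01 Lmu rL ulE ul0]] := low_strategy_small m0 hc htheta ML bL bH ct.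
  have ulge := best_ge0 (ltW c0) bL.
  split; [exact: (high_strategy_small m0 hc htheta ML bL bH ct)|by rewrite uhE|].
  exists mu; split=> //; have [mu0 mu1] := andP mu01.
  have tpos : 0 < theta.
    rewrite lt_neqAle t0 andbT; apply/eqP => t00.
    by move: ct; rewrite -t00 expr0n /= ltNge ltW.
  have mu1E : mu = 1 -> ul = theta ^+ m / m.+1%:R - c.
    by move=> e; rewrite ulE e subrr mulr0 tie_win_0.
  split=> [nc|cn].
    have ul00 : ul = 0.
      have [e|ne] := eqVneq mu 1; first by apply/eqP; rewrite eq_le ulge andbT (mu1E e) subr_le0.
      by apply: ul0; rewrite lt_neqAle ne.
    by rewrite ul00; split => //; move: ulE; rewrite ul00 => ulE; apply/eqP; rewrite -subr_eq0 -ulE.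
  (* A smaller atom would give [ul = 0] and hence [c >= tie_win m 0 theta], which is
     [theta ^+ m / m.+1%:R]. *)
  have e : mu = 1.
    apply/eqP; rewrite eq_le mu1 leNgt; apply/negP => mu1'.
    move: ulE; rewrite ul0// => /eqP; rewrite eq_sym subr_eq0 => /eqP wc.
    move: cn; rewrite -wc -tie_win_0 ltNge; apply/negP/negPn.
    by apply: tie_win_le => //; rewrite ?mulr_ge0 ?subr_ge0.
  by rewrite (mu1E e).
split=> [tb|tb].
  have tpos : 0 < theta.
    rewrite lt_neqAle t0 andbT; apply/eqP => t00.
    by move: tb; rewrite -t00 expr0n /= ltNge ltW.
  have [mu mu01 [wge weq]] : exists2 mu, 0 < mu <= 1 &
      b <= tie_win m (theta * (1 - mu)) theta /\
      (mu < 1 -> tie_win m (theta * (1 - mu)) theta = b).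
    have [nb|bn] := leP (theta ^+ m / m.+1%:R) b.
      have [mu mu01 e] := atom_size_exists m0 tpos tb nb.
      by exists mu; rewrite ?e.
    exists 1; first by rewrite ltr01 lexx.
    by rewrite subrr mulr0 tie_win_0 ltxx; split => //; exact: ltW.
  have [mu0 mu1] := andP mu01.
  have [H rH] := high_strategy_exists (b - theta ^+ m) m0 htheta.
  have {}rH : randomizes_in H b (1 - theta ^+ m + b) (Gh_small m.+1 theta b).
    move: rH; rewrite addrC subrK (_ : 1 + (b - theta ^+ m) = 1 - theta ^+ m + b); last by ring.
    move=> [H1 HG]; split=> // p /HG ->.
    by rewrite /Gh_small/= opprB addrA.
  have sb : (theta * (1 - mu)) ^+ m <= b.
    move: mu1; rewrite le_eqVlt => /predU1P[->|mu1].
      by rewrite subrr mulr0 expr0n /= ltW.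
    rewrite -(weq mu1) -[leLHS]tie_win_id.
    have X0 : 0 <= theta * (1 - mu) by rewrite mulr_ge0// subr_ge0 ltW.
    by apply: tie_win_le => //; rewrite ler_piMr// gerBl ltW.
  have mu01' : 0 <= mu <= 1 by rewrite ltW.
  have [L rL] := low_strategy_exists m0 t0 (ltW b0) mu01' sb.
  have eq := small_budget_sufficient m0 hb htheta tb mu01 rH rL wge weq.
  have [_ uhE [nu [/andP[nu0 nu1] Lnu rLnu [large_b small_b]]]] := small _ _ _ b0 tb eq.
  exists L, H; split=> //.
  - move=> L' H' eq'.
    have [rH' _ [nu' [/andP[nu0' nu1'] Lnu' rL' [large_b' small_b']]]] := small _ _ _ b0 tb eq'.
    split; last exact: randomizes_unique rH' rH.
    suff nuE : nu' = nu by rewrite nuE in rL'; exact: randomizes_unique rL' rLnu.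
    have [nb|bn] := leP (theta ^+ m / m.+1%:R) b; last first.
      by have [-> _] := small_b bn; have [-> _] := small_b' bn.
    have [_ wE] := large_b nb; have [_ wE'] := large_b' nb.
    (* The atom determines the low strategy, so uniqueness reduces to injectivity of the
       indifference equation in the atom size. *)
    have strict x y : x < y <= 1 ->
        tie_win m (theta * (1 - y)) theta < tie_win m (theta * (1 - x)) theta.
      move=> /andP[xy y1]; apply: tie_win_ltl => //.
        by rewrite mulr_ge0// subr_ge0.
      by rewrite ltr_pM2l// ltrD2l ltrN2.
    case: (ltgtP nu' nu) => // lt.
      by have := strict nu' nu; rewrite lt nu1 wE wE' ltxx => /(_ isT).
    by have := strict nu nu'; rewrite lt nu1' wE wE' ltxx => /(_ isT).
  - split=> [bn|nb].
      by rewrite Lnu; have [-> _] := small_b bn.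
    exists nu; split=> //; first by rewrite nu0.
    move=> b' mu' L' H' bb' b't eq' L'mu'.
    have b'0 := lt_trans b0 bb'.
    have [_ _ [nu' [/andP[nu'0 nu'1] Lnu' rL' [large_b' _]]]] := small _ _ _ b'0 b't eq'.
    have mu'E : mu' = nu' by apply: EFin_inj; rewrite -L'mu' -Lnu'.
    have [_ wE] := large_b nb.
    have [_ wE'] := large_b' (le_trans nb (ltW bb')).
    (* An atom at least as large would make the winning probability at the cap no larger, forcing
       [b' <= b]. *)
    rewrite mu'E ltNge; apply/negP => nunu'.
    move: bb'; rewrite -wE -wE' ltNge; apply/negP/negPn.
    by apply: tie_win_le => //; rewrite ?mulr_ge0 ?subr_ge0// ler_pM2l// lerD2l lerN2.
  - split=> //.
    + by move=> nb; have [] := large_b nb.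
    + by move=> bn; have [] := small_b bn.
have [L rL] : exists L : strategy R,
    randomizes_in L 0 (theta ^+ m) (Gl_atom m.+1 theta (theta ^+ m) 0).
  apply: low_strategy_exists => //; first exact: exprn_ge0.
    by rewrite lexx ler01.
  by rewrite subr0 mulr1.
have [H rH] := high_strategy_exists 0 m0 htheta.
split.
- move=> L' H' eq; have [M ML _] := mixture_exists L' H' ht.
  have [ul [uh [-> -> bL bH]]] := equilibrium_best ML eq.
  have [uh0 ul0] := large_budget_payoffs m0 hb htheta ML bL bH tb.
  rewrite uh0 ul0 in bL bH *; split=> //.
  exact: revenue_full_extraction ht ML bL bH.
- have prof : large_budget_profile m.+1 theta L H.
    split.
      move=> tpos; move: rL => [L1 LG]; split=> // p /andP[p0 pt].
      (* The two formulas differ in form only at [p = theta ^+ m], where [Gl_atom] returns [1] by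
         its last branch. *)
      rewrite LG ?p0// /Gl_atom/Gl_large/= subr0 expr1n mul1r.
      move: pt; rewrite le_eqVlt => /predU1P[->|->//].
      by rewrite ltxx rootXn// divff// gt_eqF.
    move: rH; rewrite !addr0 => -[H1 HG]; split=> // p /HG ->.
    by rewrite /Gh_large subr0.
  exists L, H; split=> //; apply: large_budget_sufficient => //.
  apply/eqP; rewrite eq_le probability_le1//= -(proj1 rL) le_measure ?inE//.
  by apply: subset_itvl; rewrite bnd_simp.
- by move=> L' H' L'b prof; exact: large_budget_sufficient.
Qed.
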